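(* Assume the reference-KKT-point, regularity-and-compatibility, nonlinearity, approximability, trace-residual-bound and local-neighborhood hypotheses of the context, that $\alpha>\alpha_0$, and that the radius in the local-neighborhood hypothesis satisfies $\rho\le\rho_0$. Let the residual indicator $\eta$ (defined in the context) be evaluated on a verification set satisfying the space-filling assumption of the context, with sample sizes $\widehat N_{\rm int},\widehat N_{\rm bc},\widehat N_{\rm ic},\widehat N_{\rm T}$. For each of the seven residuals $\bullet$, let $\widehat n_\bullet$ be its applicable verification sample size, and let $\mathcal E_{\rm quad}(\widehat N_{\rm int},\widehat N_{\rm bc},\widehat N_{\rm ic},\widehat N_{\rm T})$ be the corresponding covering-error term and $C_{\rm ver}:=\max_\bullet C_{\widehat n_\bullet}^{1/2}$, with the sample-dependent constants $C_{\widehat n_\bullet}$ of the context. Then, with $e_y:=y^*-Y_\theta$, $e_\lambda:=\lambda^*-\Lambda_\phi$, $e_u:=u^*-U_\psi|_\Sigma$, \[ \|(e_y,e_\lambda,e_u)\|_{\mathcal E}\lesssim C_{\rm stab}\bigl(C_{\rm ver}\,\eta+\mathcal E_{\rm quad}(\widehat N_{\rm int},\widehat N_{\rm bc},\widehat N_{\rm ic},\widehat N_{\rm T})\bigr)+C'_{\rm stab}M_{\rm bc} \] with probability at least $1-\sum_\bullet\sqrt{\widehat n_\bullet}\,(1-1/\sqrt{\widehat n_\bullet})^{\widehat n_\bullet}$.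
   Context: Notation: $A\lesssim B$ means $A\le CB$ with $C>0$ possibly depending on fixed problem data and fixed loss weights but independent of network resolution, training tolerance and collocation sample sizes. Setting. $d\ge1$; $\Omega\subset\mathbb R^d$ is a bounded domain with $C^{2+\beta}$ boundary for some $\beta\in(0,1)$; $T>0$, $Q:=\Omega\times(0,T)$, $\Sigma:=\partial\Omega\times(0,T)$; $n$ is the outward unit normal and $\partial_nv:=\nabla_xv\cdot n$ (for $d=1$ integrals over $\partial\Omega$ use counting measure). Fix $\nu>0$, $\alpha>0$, $g,y_d\in L^2(Q)$, $y_0\in L^2(\Omega)$, $f:\mathbb R\to\mathbb R$. The control problem is to minimize $J(y,u)=\frac12\int_Q|y-y_d|^2dx\,dt+\frac\alpha2\int_\Sigma|u|^2ds\,dt$ over $u\in L^2(\Sigma)$ subject to $\partial_ty-\nu\Delta y+f(y)=g$ in $Q$, $y=u$ on $\Sigma$, $y(\cdot,0)=y_0$ in $\Omega$, the state equation being understood in the transposition (very weak) sense (by duality against a regular backward dual problem with homogeneous Dirichlet and terminal data), the state belonging at least to $L^2(Q)$. The KKT system is: $\partial_ty-\nu\Delta y+f(y)-g=0$ and $-\partial_t\lambda-\nu\Delta\lambda+f'(y)\lambda+(y-y_d)=0$ in $Q$; $\alpha u+\nu\partial_n\lambda=0$, $y=u$, $\lambda=0$ on $\Sigma$; $y(\cdot,0)=y_0$, $\lambda(\cdot,T)=0$ in $\Omega$. Hölder spaces. $C^{\beta,\beta/2}(\overline Q)$: Hölder continuity of order $\beta$ in $x$ and $\beta/2$ in $t$.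 $C^{2+\beta,1+\beta/2}(\overline Q)$: additionally second spatial derivatives and the first time derivative lie in $C^{\beta,\beta/2}(\overline Q)$. $C^{2+\beta,1+\beta/2}(\Sigma)$ is the analogous space on the lateral boundary manifold. Reference-KKT-point hypothesis: the problem admits a local optimal pair $(y^*,u^* )$ and an adjoint $\lambda^*$ (all fixed) solving the KKT system, the state equation in the transposition sense, the adjoint equation in the standard variational sense, the stationarity relation in $L^2(\Sigma)$ (under the next hypothesis all equations and traces are classical). Regularity-and-compatibility hypothesis: $\partial\Omega\in C^{2+\beta}$, $y_0\in C^{2+\beta}(\overline\Omega)$, $g,y_d\in C^{\beta,\beta/2}(\overline Q)$, $u^*\in C^{2+\beta,1+\beta/2}(\Sigma)$, and $y_0=u^*(\cdot,0)$, $\partial_tu^*(\cdot,0)=\nu\Delta y_0-f(y_0)+g(\cdot,0)$ on $\partial\Omega$. Nonlinearity hypothesis: $f\in C^2(\mathbb R)$, $f'(s)\ge-c_f$ for all $s$ for some $c_f\ge0$, and $f''$ is bounded on bounded sets. Approximability hypothesis: with $\widetilde u^*$ a fixed extension of $u^*$ from $\Sigma$ to $\overline Q$, the classes of feedforward $\tanh$ networks $Y_\theta,\Lambda_\phi,U_\psi$ on $\overline Q$, indexed by a resolution $N\in\mathbb N$, admit a sequence $\epsilon_{\rm net}(N)\to0$ with $\inf_{\theta,\psi,\phi}(\|y^*-Y_\theta\|_{W^{2,\infty}(Q)}+\|\lambda^*-\Lambda_\phi\|_{W^{2,\infty}(Q)}+\|\widetilde u^*-U_\psi\|_{W^{1,\infty}(Q)})\le\epsilon_{\rm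 net}(N)$, where $W^{k,\infty}(Q)$ is the isotropic Sobolev space in all $d+1$ space-time variables. Residuals of the (fixed) trained triple. $\mathcal R_y:=\partial_tY_\theta-\nu\Delta Y_\theta+f(Y_\theta)-g$ and $\mathcal R_\lambda:=-\partial_t\Lambda_\phi-\nu\Delta\Lambda_\phi+f'(Y_\theta)\Lambda_\phi+Y_\theta-y_d$ on $Q$; $\mathcal R_u:=\alpha U_\psi+\nu\partial_n\Lambda_\phi$, $R^y_{\rm bc}:=(Y_\theta-U_\psi)|_\Sigma$, $R^\lambda_{\rm bc}:=\Lambda_\phi|_\Sigma$ on $\Sigma$; $R^y_{\rm ic}:=Y_\theta(\cdot,0)-y_0=:-e_{y,0}$ and $R^\lambda_T:=\Lambda_\phi(\cdot,T)$ on $\Omega$. These are the seven residuals $\bullet$, with domains $D_\bullet\in\{Q,\Sigma,\Omega\}$ of dimension $d_\bullet\in\{d+1,d\}$. Trace-residual-bound hypothesis: along the sequence of trained networks, $\|R^y_{\rm bc}\|_{C^{2+\beta,1+\beta/2}(\Sigma)}$, $\|R^\lambda_{\rm bc}\|_{C^{2+\beta,1+\beta/2}(\Sigma)}$, $\|R^\lambda_T\|_{C^{2+\beta}(\overline\Omega)}\le M_{\rm bc}$ for some $M_{\rm bc}<\infty$ independent of network size. (The corner agreement $R^\lambda_{\rm bc}(x,T)=R^\lambda_T(x)$, $x\in\partial\Omega$, is automatic.) Local-neighborhood hypothesis: for the trained triples considered there is $\rho>0$ with $\|Y_\theta-y^*\|_{L^\infty(Q)}+\|\Lambda_\phi-\lambda^*\|_{L^\infty(Q)}\le\rho$;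 moreover there is a compact interval $I$ containing the ranges of $y^*$ and all trained states considered on which $f''$ is Lipschitz. Indicator. Independent verification sets $\{q_k\}_{k=1}^{\widehat N_{\rm int}}\subset Q$, $\{s_k\}_{k=1}^{\widehat N_{\rm bc}}\subset\Sigma$, $\{x_k^0\}_{k=1}^{\widehat N_{\rm ic}}\subset\Omega$, $\{x_k^T\}_{k=1}^{\widehat N_{\rm T}}\subset\Omega$ are given with positive quadrature weights $\omega_k^Q,\omega_k^\Sigma,\omega_k^0,\omega_k^T$ normalized for the corresponding sampling measures (each family sums to one), and \[ \eta^2:=\sum_k\omega_k^Q\bigl(|\mathcal R_y(q_k)|^2+|\mathcal R_\lambda(q_k)|^2\bigr)+\sum_k\omega_k^\Sigma\bigl(|\mathcal R_u(s_k)|^2+|R^y_{\rm bc}(s_k)|^2+|R^\lambda_{\rm bc}(s_k)|^2\bigr)+\sum_k\omega_k^0|R^y_{\rm ic}(x_k^0)|^2+\sum_k\omega_k^T|R^\lambda_T(x_k^T)|^2 . \] The applicable sample size $\widehat n_\bullet$ is $\widehat N_{\rm int}$ for $\mathcal R_y,\mathcal R_\lambda$; $\widehat N_{\rm bc}$ for $\mathcal R_u,R^y_{\rm bc},R^\lambda_{\rm bc}$; $\widehat N_{\rm ic}$ for $R^y_{\rm ic}$; $\widehat N_{\rm T}$ for $R^\lambda_T$. Space-filling assumption: the interior, initial and terminal points are i.i.d. draws from probability distributions with density bounded above and below on their domains; boundary points are sampled independently on each connected component of $\Sigma$ with componentwise densities bounded above and below. Residuals may share a batch; no independence between the corresponding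 error events is assumed. Quadrature constants. With $\|v\|^2_{L^2_{\rm av}(D)}:=|D|^{-1}\int_D|v|^2$, $\mathcal L_\bullet$ the empirical quadrature value of $|\bullet|^2$ on a sample of size $m$, and $\beta_\bullet\in(0,1]$ the Hölder exponent of $\bullet$, $C_m=O(\sqrt m)$ and $C'$ (depending on the Hölder seminorm of the residual of the fixed network and the density bounds) are constants such that, for each $\bullet$, with probability at least $1-\sqrt m(1-1/\sqrt m)^m$, $\|\bullet\|^2_{L^2_{\rm av}(D_\bullet)}\le C_m\mathcal L_\bullet+C'm^{-\beta_\bullet/d_\bullet}$. $\mathcal E_{\rm quad}(\widehat N_{\rm int},\widehat N_{\rm bc},\widehat N_{\rm ic},\widehat N_{\rm T})$ is the square root of the sum of the seven additive terms $C'\widehat n_\bullet^{-\beta_\bullet/d_\bullet}$. Error norm: $\|(e_y,e_\lambda,e_u)\|_{\mathcal E}^2:=\|e_y\|_{L^2(Q)}^2+\|e_\lambda\|_{L^2(0,T;H^1(\Omega))}^2+\|e_u\|_{L^2(\Sigma)}^2$. Stability constants. Let $a:=f'(y^* )$, $M_a:=\|a\|_{L^\infty(Q)}$, $\kappa:=f''(y^* )\lambda^*$, $M_\kappa:=\sup_{\overline Q}|\kappa|$. $C_2,C_3>0$ are constants depending only on $\nu,\Omega,T,c_f,M_a$, and $\alpha_0:=4\sqrt2\,\nu(1+M_\kappa)\sqrt{C_2}\,C_3$. For $\alpha>\alpha_0$, $C_{\rm stab}$ (depending on $\nu,\Omega,T,c_f,M_a,M_\kappa,\alpha$) and $C'_{\rm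 stab}$ (depending additionally on a parabolic Schauder constant for the operator with coefficient $a$) are constants such that, for arbitrary $F_y,F_\lambda\in L^2(Q)$, every solution of $\partial_te_y-\nu\Delta e_y+ae_y=F_y$ in $Q$, $e_y=e_u-R^y_{\rm bc}$ on $\Sigma$, $e_y(\cdot,0)=e_{y,0}$; $-\partial_te_\lambda-\nu\Delta e_\lambda+ae_\lambda+(\kappa+1)e_y=F_\lambda$ in $Q$, $e_\lambda=-R^\lambda_{\rm bc}$ on $\Sigma$, $e_\lambda(\cdot,T)=-R^\lambda_T$; $\alpha e_u+\nu\partial_ne_\lambda=-\mathcal R_u$ on $\Sigma$, satisfies $\|(e_y,e_\lambda,e_u)\|_{\mathcal E}\le C_{\rm stab}(\|e_{y,0}\|_{L^2(\Omega)}+\|F_y\|_{L^2(Q)}+\|F_\lambda\|_{L^2(Q)}+\|\mathcal R_u\|_{L^2(\Sigma)}+\|R^y_{\rm bc}\|_{L^2(\Sigma)})+C'_{\rm stab}M_{\rm bc}$. Finally $\rho_0=1/(2C_{\rm stab}C_{\rm nl})>0$ is a radius, depending only on the reference KKT point, the Lipschitz bound for $f''$ and the preceding constants, such that $\rho\le\rho_0$ implies for the trained triple $\|(y^*-Y_\theta,\lambda^*-\Lambda_\phi,u^*-U_\psi|_\Sigma)\|_{\mathcal E}\le2C_{\rm stab}(\|e_{y,0}\|_{L^2(\Omega)}+\|\mathcal R_y\|_{L^2(Q)}+\|\mathcal R_\lambda\|_{L^2(Q)}+\|\mathcal R_u\|_{L^2(\Sigma)}+\|R^y_{\rm bc}\|_{L^2(\Sigma)})+2C'_{\rm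 stab}M_{\rm bc}$. *)

(* Defs.v *)
From HB Require Import structures.
From mathcomp Require Import all_boot all_order all_algebra.
From mathcomp Require Import all_classical all_reals all_analysis.
From mathcomp Require Import ess_sup_inf.

Set Implicit Arguments.
Unset Strict Implicit.
Unset Printing Implicit Defensive.

Import Order.TTheory GRing.Theory Num.Theory.
Import numFieldNormedType.Exports.

Local Open Scope classical_set_scope.
Local Open Scope ring_scope.

(* On [T] equipped with the sigma-algebra of all its subsets, [mu_ext] is the
   outer measure given by countable covers by arbitrary sets, each set counted
   with the weight [w].  A set that must not be used gets the weight [+oo]. *)
Definition cover_measure (R : realType) (T : pointedType)
    (w : set T -> \bar R) (A : set T) : \bar R :=
  mu_ext (w : set (g_sigma_algebraType [set: set T]) -> \bar R) A.

Section euclidean.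
Context (R : realType).

Definition enorm n (x : 'rV[R]_n) : R := Num.sqrt (\sum_(i < n) x ord0 i ^+ 2).

Definition eball n (x : 'rV[R]_n) (r : R) : set 'rV[R]_n :=
  [set y | enorm (y - x) < r].

Definition dotv n (x y : 'rV[R]_n) : R := \sum_(i < n) x ord0 i * y ord0 i.

Definition box n (a b : 'rV[R]_n) : set 'rV[R]_n :=
  [set x | forall i, a ord0 i <= x ord0 i < b ord0 i].

Definition box_volume n (A : set 'rV[R]_n.+1) : \bar R :=
  ereal_inf [set v | exists a b : 'rV[R]_n.+1,
    [/\ forall i, a ord0 i <= b ord0 i, A = box a b &
        v = (\prod_i (b ord0 i - a ord0 i))%:E]].

Definition lebesgue_outer n (A : set 'rV[R]_n.+1) : \bar R :=
  cover_measure (@box_volume n) A.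

(* Volume of the unit ball of R^s:
   omega_0 = 1, omega_1 = 2, omega_s = (2 pi / s) omega_(s-2). *)
Fixpoint ball_volume (s : nat) : R :=
  match s with
  | 0 => 1
  | 1 => 2
  | k.+2 => 2 * pi / k.+2%:R * ball_volume k
  end.

Definition ediam n (A : set 'rV[R]_n) : \bar R :=
  ereal_sup [set (enorm (p.1 - p.2))%:E | p in A `*` A].

(* The weight omega_s (diam A / 2)^s; with s = 0 every nonempty set has
   weight 1, so that the 0-dimensional measure is the counting measure. *)
Definition hausdorff_weight n (s : nat) (delta : R) (A : set 'rV[R]_n) : \bar R :=
  if `[< A = set0 >] then 0%E
  else if (ediam A <= delta%:E)%E
       then ((ball_volume s / 2 ^+ s)%:E * (ediam A) ^+ s)%E
       else +oo%E.

(* The s-dimensional Hausdorff measure normalised so that on an s-dimensional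
   C^1 submanifold it is the usual surface measure. *)
Definition hausdorff_outer n (s : nat) (A : set 'rV[R]_n) : \bar R :=
  ereal_sup [set cover_measure (hausdorff_weight s delta) A |
             delta in [set delta : R | 0 < delta]].

End euclidean.

Section outer_measure_instances.
Context (R : realType).
Local Open Scope ereal_scope.

Lemma box_volume0 n : @box_volume R n set0 = 0.
Proof.
apply/eqP; rewrite eq_le; apply/andP; split.
  apply: ereal_inf_lbound; exists 0%R, 0%R; split => //.
    apply/seteqP; split => // x /(_ ord0); rewrite mxE.
    by move=> /andP[h1 /(le_lt_trans h1)]; rewrite ltxx.
  by rewrite (bigD1 ord0)//= mxE subrr mul0r.
apply: le_ereal_inf_tmp => _ [a [b [ab _ ->]]].
by rewrite lee_fin prodr_ge0// => i _; rewrite subr_ge0.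
Qed.

Lemma box_volume_ge0 n A : 0 <= @box_volume R n A.
Proof.
apply: le_ereal_inf_tmp => _ [a [b [ab _ ->]]].
by rewrite lee_fin prodr_ge0// => i _; rewrite subr_ge0.
Qed.

Lemma ball_volume_ge0 s : (0 <= @ball_volume R s)%R.
Proof.
suff : (0 <= @ball_volume R s)%R /\ (0 <= @ball_volume R s.+1)%R by case.
elim: s => [|s [h1 h2]]; first by split.
by split => //=; rewrite mulr_ge0// divr_ge0// mulr_ge0// pi_ge0.
Qed.

Lemma hausdorff_weight0 n s delta : @hausdorff_weight R n s delta set0 = 0.
Proof. by rewrite /hausdorff_weight; case: asboolP. Qed.

Lemma hausdorff_weight_ge0 n s delta A : 0 <= @hausdorff_weight R n s delta A.
Proof.
rewrite /hausdorff_weight; case: asboolP => // A0; case: ifPn => // _.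
rewrite mule_ge0//; first by rewrite lee_fin divr_ge0// ball_volume_ge0.
rewrite expe_ge0//; move/eqP/set0P : A0 => [x Ax].
apply: (@le_trans _ _ (enorm (x - x))%:E); first by rewrite lee_fin sqrtr_ge0.
by apply: ereal_sup_ubound; exists (x, x).
Qed.

Lemma lebesgue_outer0 n : @lebesgue_outer R n set0 = 0.
Proof. apply: mu_ext0; [exact: box_volume0|exact: box_volume_ge0]. Qed.

Lemma lebesgue_outer_ge0 n A : 0 <= @lebesgue_outer R n A.
Proof. exact/mu_ext_ge0/box_volume_ge0. Qed.

Lemma le_lebesgue_outer n :
  {homo @lebesgue_outer R n : A B / A `<=` B >-> A <= B}.
Proof. by move=> A B AB; rewrite /lebesgue_outer /cover_measure; apply: le_mu_ext. Qed.

Lemma lebesgue_outer_sigma_subadditive n :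
  sigma_subadditive (@lebesgue_outer R n).
Proof.
move=> F; rewrite /lebesgue_outer /cover_measure.
exact: (@mu_ext_sigma_subadditive _ (g_sigma_algebraType _) R _
          (@box_volume_ge0 n)).
Qed.

HB.instance Definition _ n := isOuterMeasure.Build R 'rV[R]_n.+1
  (@lebesgue_outer R n) (lebesgue_outer0 n) (@lebesgue_outer_ge0 n)
  (@le_lebesgue_outer n) (@lebesgue_outer_sigma_subadditive n).

Lemma hausdorff_outer_ge0 n s A : 0 <= @hausdorff_outer R n s A.
Proof.
apply: (@le_trans _ _ (cover_measure (hausdorff_weight s 1) A)).
  exact/mu_ext_ge0/hausdorff_weight_ge0.
by apply: ereal_sup_ubound; exists 1%R => //=.
Qed.

Lemma hausdorff_outer0 n s : @hausdorff_outer R n s set0 = 0.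
Proof.
apply/eqP; rewrite eq_le hausdorff_outer_ge0 andbT.
apply: ge_ereal_sup => _ [delta _ <-].
rewrite /cover_measure mu_ext0//; first exact: hausdorff_weight0.
exact: hausdorff_weight_ge0.
Qed.

Lemma le_hausdorff_outer n s :
  {homo @hausdorff_outer R n s : A B / A `<=` B >-> A <= B}.
Proof.
move=> A B AB; apply: ge_ereal_sup => _ [delta d0 <-].
apply: (@le_trans _ _ (cover_measure (hausdorff_weight s delta) B)).
  by rewrite /cover_measure; apply: le_mu_ext.
by apply: ereal_sup_ubound; exists delta.
Qed.

Lemma hausdorff_outer_sigma_subadditive n s :
  sigma_subadditive (@hausdorff_outer R n s).
Proof.
move=> F; apply: ge_ereal_sup => _ [delta d0 <-].
have wge0 := @hausdorff_weight_ge0 n s delta.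
apply: (le_trans (@mu_ext_sigma_subadditive _ (g_sigma_algebraType _) R _
  wge0 F)).
apply: lee_nneseries => [k _ _|k _]; first exact: mu_ext_ge0.
by apply: ereal_sup_ubound; exists delta.
Qed.

HB.instance Definition _ n s := isOuterMeasure.Build R 'rV[R]_n
  (@hausdorff_outer R n s) (hausdorff_outer0 n s) (@hausdorff_outer_ge0 n s)
  (@le_hausdorff_outer n s) (@hausdorff_outer_sigma_subadditive n s).

End outer_measure_instances.

Section calculus.
Context (R : realType) (n : nat).
Local Notation st := ('rV[R]_n * R)%type.

(* [Some i] is the i-th spatial direction, [None] is the time direction. *)
Definition dir (o : option 'I_n) : st :=
  if o is Some i then (delta_mx ord0 i, 0) else (0, 1).

Definition pd (o : option 'I_n) (v : st -> R) : st -> R :=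
  fun p => 'D_(dir o) v p.

Definition grad (v : st -> R) (p : st) : 'rV[R]_n :=
  \row_(i < n) pd (Some i) v p.

Definition lap (v : st -> R) (p : st) : R :=
  \sum_(i < n) pd (Some i) (pd (Some i) v) p.

Definition spd (i : 'I_n) (v : 'rV[R]_n -> R) : 'rV[R]_n -> R :=
  fun x => 'D_(delta_mx ord0 i) v x.

Definition slap (v : 'rV[R]_n -> R) (x : 'rV[R]_n) : R :=
  \sum_(i < n) spd i (spd i v) x.

Definition cyl (D : set 'rV[R]_n) (T : R) : set st :=
  D `*` [set t | 0 < t < T].

Definition ccyl (D : set 'rV[R]_n) (T : R) : set st :=
  D `*` [set t | 0 <= t <= T].

Definition stdist (p q : st) : R :=
  Num.sqrt (enorm (p.1 - q.1) ^+ 2 + (p.2 - q.2) ^+ 2).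

Definition sup_norm (X : Type) (D : set X) (v : X -> R) : \bar R :=
  ereal_sup [set `|v x|%:E | x in D].

(* The diagonal pairs contribute 0 because [0 / 0 = 0]. *)
Definition holder_seminorm (X : Type) (dist : X -> X -> R) (b : R)
    (D : set X) (v : X -> R) : \bar R :=
  ereal_sup [set (`|v p.1 - v p.2| / (dist p.1 p.2 `^ b))%:E | p in D `*` D].

Definition sdist (x y : 'rV[R]_n) : R := enorm (x - y).

Definition twice_derivable (D : set 'rV[R]_n) (v : 'rV[R]_n -> R) : Prop :=
  forall x, D x -> (forall i, derivable v x (delta_mx ord0 i)) /\
    (forall i j, derivable (spd i v) x (delta_mx ord0 j)).

(* The C^(2+b)(closure D) norm, D open: derivatives are taken in D, where being
   bounded and Hoelder continuous they extend to the closure. *)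
Definition holder2_norm (b : R) (D : set 'rV[R]_n) (v : 'rV[R]_n -> R) : \bar R :=
  (sup_norm D v + \sum_(i < n) sup_norm D (spd i v)
   + \sum_(i < n) \sum_(j < n) (sup_norm D (spd j (spd i v))
       + holder_seminorm sdist b D (spd j (spd i v))))%E.

Definition holder2_le (b : R) (D : set 'rV[R]_n) (v : 'rV[R]_n -> R) (M : R) : Prop :=
  twice_derivable D v /\ (holder2_norm b D v <= M%:E)%E.

Definition in_holder2 (b : R) (D : set 'rV[R]_n) (v : 'rV[R]_n -> R) : Prop :=
  {within closure D, continuous v} /\ exists M, holder2_le b D v M.

Definition pholder_x (b : R) (D : set 'rV[R]_n) (T : R) (v : st -> R) : \bar R :=
  ereal_sup [set z | exists x y t, [/\ D x, D y, 0 < t < T &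
    z = (`|v (x, t) - v (y, t)| / (enorm (x - y) `^ b))%:E]].

Definition pholder_t (b : R) (D : set 'rV[R]_n) (T : R) (v : st -> R) : \bar R :=
  ereal_sup [set z | exists x s t, [/\ D x, 0 < s < T, 0 < t < T &
    z = (`|v (x, s) - v (x, t)| / (`|s - t| `^ b))%:E]].

(* The norm of C^(b, b/2) on the closure of D x (0, T). *)
Definition pholder_norm (b : R) (D : set 'rV[R]_n) (T : R) (v : st -> R) : \bar R :=
  (sup_norm (cyl D T) v + pholder_x b D T v + pholder_t (b / 2) D T v)%E.

Definition in_pholder (b : R) (D : set 'rV[R]_n) (T : R) (v : st -> R) : Prop :=
  {within ccyl (closure D) T, continuous v} /\
  exists M : R, (pholder_norm b D T v <= M%:E)%E.

Definition derivable21 (D : set st) (v : st -> R) : Prop :=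
  forall p, D p -> (forall o, derivable v p (dir o)) /\
    (forall i j, derivable (pd (Some i) v) p (dir (Some j))).

(* The norm of C^(2+b, 1+b/2) on the closure of D x (0, T). *)
Definition pholder2_norm (b : R) (D : set 'rV[R]_n) (T : R) (v : st -> R) : \bar R :=
  (pholder_norm b D T v + \sum_(i < n) pholder_norm b D T (pd (Some i) v)
   + \sum_(i < n) \sum_(j < n) pholder_norm b D T (pd (Some j) (pd (Some i) v))
   + pholder_norm b D T (pd None v))%E.

Definition pholder2_le (b : R) (D : set 'rV[R]_n) (T : R) (v : st -> R) (M : R) : Prop :=
  derivable21 (cyl D T) v /\ (pholder2_norm b D T v <= M%:E)%E.

Definition C21 (D : set st) (v : st -> R) : Prop :=
  [/\ derivable21 D v, {within D, continuous v},
      forall o, {within D, continuous (pd o v)} &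
      forall i j, {within D, continuous (pd (Some j) (pd (Some i) v))}].

Definition test_fun (D : set st) (phi : st -> R) : Prop :=
  (forall (s : seq (option 'I_n)) p, differentiable (foldr pd phi s) p) /\
  exists2 K : set st, compact K /\ K `<=` D & forall p, ~ K p -> phi p = 0.

End calculus.

Definition tanh (R : realType) (t : R) : R :=
  (expR t - expR (- t)) / (expR t + expR (- t)).

Inductive mlp (R : realType) : nat -> Type :=
| Affine n (w : 'cV[R]_n) (b : R) : mlp R n
| Hidden n k (W : 'M[R]_(n, k)) (b : 'rV[R]_k) (N : mlp R k) : mlp R n.

Fixpoint mlp_eval (R : realType) n (N : mlp R n) : 'rV[R]_n -> R :=
  match N in mlp _ n return 'rV[R]_n -> R with
  | Affine _ w b => fun x => (x *m w) ord0 ord0 + b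
  | Hidden _ _ W b N' => fun x => mlp_eval N' (map_mx (@tanh R) (x *m W + b))
  end.

(* In the rotated coordinates [x *m frame] the boundary is locally the graph of
   [height] over a ball of R^(d-1), d = m.+1, and the domain lies above it. *)
Record chart (R : realType) (m : nat) := Chart {
  frame : 'M[R]_m.+1;
  center : 'rV[R]_m;
  radius : R;
  thickness : R;
  height : 'rV[R]_m -> R }.

Section geometry.
Context (R : realType) (m : nat).
Local Notation pt := 'rV[R]_m.+1.
Local Notation st := ('rV[R]_m.+1 * R)%type.

Definition stack (z : 'rV[R]_m) (s : R) : pt :=
  \row_(i < m.+1) if unlift ord_max i is Some j then z ord0 j else s.

Definition base (c : chart R m) (x : pt) : 'rV[R]_m :=
  \row_(j < m) (x *m frame c) ord0 (lift ord_max j).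

Definition top (c : chart R m) (x : pt) : R := (x *m frame c) ord0 ord_max.

Definition patch (c : chart R m) : set pt :=
  [set x | eball (center c) (radius c) (base c x) /\
           `|top c x - height c (base c x)| < thickness c].

Definition chart_param (c : chart R m) (z : 'rV[R]_m) : pt :=
  stack z (height c z) *m (frame c)^T.

Definition bdry (D : set pt) : set pt := closure D `\` D.

Definition chart_of (b : R) (D : set pt) (c : chart R m) : Prop :=
  [/\ frame c *m (frame c)^T = 1%:M, 0 < radius c, 0 < thickness c,
      in_holder2 b (eball (center c) (radius c)) (height c) &
      forall x, patch c x ->
        (D x <-> height c (base c x) < top c x) /\
        (bdry D x <-> top c x = height c (base c x))].

Definition holder_domain (b : R) (D : set pt) k (atlas : 'I_k -> chart R m) : Prop :=
  [/\ open D, connected D, D !=set0, bounded_set D &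
      (forall i, chart_of b D (atlas i)) /\
      (forall x, bdry D x -> exists i, patch (atlas i) x)].

Definition chart_normal (c : chart R m) (z : 'rV[R]_m) : pt :=
  let g := \row_(j < m) spd j (height c) z in
  ((Num.sqrt (1 + dotv g g))^-1 *: stack g (- 1)) *m (frame c)^T.

(* The outward unit normal, read off any chart around [x]. *)
Definition normal k (atlas : 'I_k -> chart R m) (x : pt) : pt :=
  if [pick i | `[< patch (atlas i) x >]] is Some i
  then chart_normal (atlas i) (base (atlas i) x) else 0.

(* The C^(2+b, 1+b/2) norm on (bdry D) x (0, T) is the maximum over the fixed
   finite atlas of the norms of the local representatives. *)
Definition lateral_pholder2_le (b : R) k (atlas : 'I_k -> chart R m) (T : R)
    (v : st -> R) (M : R) : Prop :=
  forall i, pholder2_le b (eball (center (atlas i)) (radius (atlas i))) T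
              (fun q => v (chart_param (atlas i) q.1, q.2)) M.

Local Notation ptL := (caratheodory_type (@lebesgue_outer R m)).
Local Notation ptS := (caratheodory_type (@hausdorff_outer R m.+1 m)).

Definition leb : {measure set ptL -> \bar R} :=
  (@lebesgue_outer R m : {outer_measure set pt -> \bar R}).
Definition surf : {measure set ptS -> \bar R} :=
  (@hausdorff_outer R m.+1 m : {outer_measure set pt -> \bar R}).

Definition leb_t : {measure set (ptL * measurableTypeR R) -> \bar R} :=
  (leb \x (@lebesgue_measure R))%E.
Definition surf_t : {measure set (ptS * measurableTypeR R) -> \bar R} :=
  (surf \x (@lebesgue_measure R))%E.

End geometry.
Arguments leb {R m}.
Arguments surf {R m}.
Arguments leb_t {R m}.
Arguments surf_t {R m}.

Section norms.
Context (R : realType).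
Local Open Scope ereal_scope.

Section lebesgue.
Context d (X : measurableType d) (mu : {measure set X -> \bar R}).

Definition sqL2 (D : set X) (v : X -> R) : \bar R :=
  \int[mu]_(x in D) ((v x) ^+ 2)%:E.

Definition L2 (D : set X) (v : X -> R) : \bar R := sqrte (sqL2 D v).

Definition sqL2av (D : set X) (v : X -> R) : \bar R := (mu D)^-1 * sqL2 D v.

Definition in_L2 (D : set X) (v : X -> R) : Prop :=
  measurable_fun D v /\ sqL2 D v < +oo.

Definition Linf (D : set X) (v : X -> R) : \bar R :=
  ess_sup mu (fun x => `|(v \_ D) x|%:E).

End lebesgue.

Context (m : nat).
Local Notation st := ('rV[R]_m.+1 * R)%type.

Definition weak_pd (D : set st) (o : option 'I_m.+1) (v w : st -> R) : Prop :=
  forall phi, test_fun D phi ->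
    (\int[leb_t]_(p in D) (v p * pd o phi p) =
     - \int[leb_t]_(p in D) (w p * phi p))%R.

Fixpoint sobolev_inf_le (k : nat) (D : set st) (v : st -> R) (M : R) : Prop :=
  [/\ measurable_fun (D : set (caratheodory_type (@lebesgue_outer R m) * measurableTypeR R)) v,
      Linf leb_t D v <= M%:E &
      match k with
      | 0 => True
      | k'.+1 => forall o, exists2 w, weak_pd D o v w & sobolev_inf_le k' D w M
      end].

(* The W^(k, oo)(D) norm, i.e. the maximum of the L^oo norms of the weak
   derivatives of order at most k in all the d+1 variables; [+oo] if they do not
   exist. *)
Definition sobolev_inf (k : nat) (D : set st) (v : st -> R) : \bar R :=
  ereal_inf [set M%:E | M in [set M : R | sobolev_inf_le k D v M]].

(* The squared norm of L^2(0,T; H^1) of a function with spatial gradient [G]. *)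
Definition sqL2H1 (D : set st) (v : st -> R) (G : 'I_m.+1 -> st -> R) : \bar R :=
  sqL2 leb_t D v + \sum_(i < m.+1) sqL2 leb_t D (G i).

End norms.

Record problem (R : realType) (m : nat) := Problem {
  dom : set 'rV[R]_m.+1;
  nb_charts : nat;
  atlas : 'I_nb_charts -> chart R m;
  horizon : R;
  nu : R;
  alpha : R;
  source : 'rV[R]_m.+1 * R -> R;
  y_d : 'rV[R]_m.+1 * R -> R;
  y_0 : 'rV[R]_m.+1 -> R;
  nonlin : R -> R }.

Section control_problem.
Context (R : realType) (m : nat) (pb : problem R m).
Local Notation pt := 'rV[R]_m.+1.
Local Notation st := ('rV[R]_m.+1 * R)%type.
Local Notation Om := (dom pb).
Local Notation T := (horizon pb).
Local Notation nu := (nu pb).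
Local Notation alpha := (alpha pb).
Local Notation g := (source pb).
Local Notation yd := (y_d pb).
Local Notation y0 := (y_0 pb).
Local Notation f := (nonlin pb).
Local Notation f' := (derive1 f).
Local Notation f'' := (derive1 f').

Definition Q : set st := cyl Om T.
Definition Qbar : set st := ccyl (closure Om) T.
Definition Sig : set st := cyl (bdry Om) T.

Definition dn (v : st -> R) (p : st) : R :=
  dotv (grad v p) (normal (@atlas R m pb) p.1).

Definition setting (b : R) : Prop :=
  [/\ 0 < b < 1, holder_domain b Om (@atlas R m pb), 0 < T, 0 < nu & 0 < alpha] /\
  [/\ in_L2 leb_t Q g, in_L2 leb_t Q yd & in_L2 leb Om y0].

(* The regular dual functions: C^(2,1) up to the boundary (they are taken
   defined on the whole space-time) and vanishing on the lateral boundary. *)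
Definition dual_fun (phi : st -> R) : Prop :=
  C21 setT phi /\ forall p, Sig p -> phi p = 0.

Definition very_weak_state (y u : st -> R) : Prop :=
  forall phi, dual_fun phi -> (forall x, Om x -> phi (x, T) = 0) ->
    \int[leb_t]_(p in Q)
       (y p * (- pd None phi p - nu * lap phi p) + f (y p) * phi p) =
    \int[leb_t]_(p in Q) (g p * phi p)
    + \int[leb]_(x in Om) (y0 x * phi (x, 0))
    - nu * \int[surf_t]_(p in Sig) (u p * dn phi p).

Definition feasible (y u : st -> R) : Prop :=
  [/\ in_L2 leb_t Q y, in_L2 surf_t Sig u,
      leb_t.-integrable Q (EFin \o (f \o y)) & very_weak_state y u].

Definition cost (y u : st -> R) : R :=
  2^-1 * \int[leb_t]_(p in Q) ((y p - yd p) ^+ 2)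
  + alpha / 2 * \int[surf_t]_(p in Sig) (u p ^+ 2).

Definition local_optimal (y u : st -> R) : Prop :=
  feasible y u /\ exists2 r : R, 0 < r & forall y' u', feasible y' u' ->
    (L2 leb_t Q (y' \- y)%R + L2 surf_t Sig (u' \- u)%R < r%:E)%E ->
    cost y u <= cost y' u'.

(* The adjoint equation in the variational sense; the test functions vanish on
   the lateral boundary and at the initial time, the condition l(., T) = 0 is
   thus natural. *)
Definition weak_adjoint (y l : st -> R) : Prop :=
  in_L2 leb_t Q l /\ exists G : 'I_m.+1 -> st -> R,
    (forall i, weak_pd Q (Some i) l (G i) /\ in_L2 leb_t Q (G i)) /\
    forall phi, dual_fun phi -> (forall x, Om x -> phi (x, 0) = 0) ->
      \int[leb_t]_(p in Q) (l p * pd None phi p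
          + nu * (\sum_(i < m.+1) G i p * pd (Some i) phi p)
          + f' (y p) * l p * phi p + (y p - yd p) * phi p) = 0.

(* All equations and traces in the classical sense; the normal derivative of
   [l] is that of the continuous extension of its gradient to the lateral
   boundary. *)
Definition classical_kkt (y u l : st -> R) : Prop :=
  [/\ C21 Q y /\ C21 Q l,
      {within Qbar, continuous y} /\ {within Qbar, continuous l},
      (forall p, Q p ->
         pd None y p - nu * lap y p + f (y p) - g p = 0 /\
         - pd None l p - nu * lap l p + f' (y p) * l p + (y p - yd p) = 0),
      (forall p, Sig p -> y p = u p /\ l p = 0) /\
      (forall x, Om x -> y (x, 0) = y0 x /\ l (x, T) = 0) &
      exists G : st -> pt,
        [/\ {within cyl (closure Om) T, continuous G},
            forall p, Q p -> G p = grad l p &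
            forall p, Sig p ->
              alpha * u p + nu * dotv (G p) (normal (@atlas R m pb) p.1) = 0]].

(* In the regularity class below all equations and traces are classical, which
   is why both readings are recorded. *)
Definition reference_kkt (y u l : st -> R) : Prop :=
  [/\ local_optimal y u, weak_adjoint y l & classical_kkt y u l].

Definition lateral_pholder2 (b : R) (v : st -> R) : Prop :=
  {within ccyl (bdry Om) T, continuous v} /\
  exists M, lateral_pholder2_le b (@atlas R m pb) T v M.

Definition regular_compatible (b : R) (u : st -> R) : Prop :=
  [/\ in_holder2 b Om y0, in_pholder b Om T g /\ in_pholder b Om T yd,
      lateral_pholder2 b u,
      forall x, bdry Om x -> y0 x = u (x, 0) &
      forall x, bdry Om x -> exists lapy0 : R,
        slap y0 z @[z --> within Om (nbhs x)] --> lapy0 /\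
        h^-1 * (u (x, h) - u (x, 0)) @[h --> 0^'+] -->
          nu * lapy0 - f (y0 x) + g (x, 0)].

Definition nonlinearity (cf : R) : Prop :=
  [/\ forall s, derivable f s 1 /\ derivable f' s 1,
      continuous f'',
      0 <= cf /\ (forall s, - cf <= f' s) &
      forall r : R, exists M : R, forall s, `|s| <= r -> `|f'' s| <= M].

Record triple := Triple {
  netY : mlp R (m.+1 + 1);
  netL : mlp R (m.+1 + 1);
  netU : mlp R (m.+1 + 1) }.

Definition realize (N : mlp R (m.+1 + 1)) : st -> R :=
  fun p => mlp_eval N (row_mx p.1 (p.2)%:M).

Section residuals.
Context (tr : triple).
Local Notation Y := (realize (netY tr)).
Local Notation L := (realize (netL tr)).
Local Notation U := (realize (netU tr)).

Definition R_y : st -> R := fun p => pd None Y p - nu * lap Y p + f (Y p) - g p.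
Definition R_l : st -> R := fun p =>
  - pd None L p - nu * lap L p + f' (Y p) * L p + Y p - yd p.
Definition R_u : st -> R := fun p => alpha * U p + nu * dn L p.
Definition R_bcy : st -> R := fun p => Y p - U p.
Definition R_bcl : st -> R := L.
Definition R_icy : pt -> R := fun x => Y (x, 0) - y0 x.
Definition R_Tl : pt -> R := fun x => L (x, T).

Definition trace_bound (b M : R) : Prop :=
  [/\ lateral_pholder2_le b (@atlas R m pb) T R_bcy M,
      lateral_pholder2_le b (@atlas R m pb) T R_bcl M &
      holder2_le b Om R_Tl M].

(* The right-hand side of the stability estimates, for data [Fy], [Fl]. *)
Definition stab_rhs (C C' M : R) (Fy Fl : st -> R) : \bar R :=
  (C%:E * (L2 leb Om (\- R_icy)%R + L2 leb_t Q Fy + L2 leb_t Q Fl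
           + L2 surf_t Sig R_u + L2 surf_t Sig R_bcy) + (C' * M)%:E)%E.

End residuals.

Definition error_norm (ey el : st -> R) (G : 'I_m.+1 -> st -> R) (eu : st -> R)
    : \bar R :=
  sqrte (sqL2 leb_t Q ey + sqL2H1 Q el G + sqL2 surf_t Sig eu)%E.

(* The linear error system with coefficients [a] and [kappa], in the sense of
   transposition.  In the second equation the test functions are not required to
   vanish on the lateral boundary, so that it also contains the relation
   alpha eu + nu dn el = - R_u there; [G] is the spatial gradient of [el]. *)
Definition linear_error_system (tr : triple) (a kappa Fy Fl : st -> R)
    (ey el : st -> R) (G : 'I_m.+1 -> st -> R) (eu : st -> R) : Prop :=
  [/\ [/\ in_L2 leb_t Q ey, in_L2 leb_t Q el & in_L2 surf_t Sig eu],
      forall i, weak_pd Q (Some i) el (G i) /\ in_L2 leb_t Q (G i),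
      forall phi, dual_fun phi -> (forall x, Om x -> phi (x, T) = 0) ->
        \int[leb_t]_(p in Q)
           (ey p * (- pd None phi p - nu * lap phi p + a p * phi p)) =
        \int[leb_t]_(p in Q) (Fy p * phi p)
        + \int[leb]_(x in Om) (- R_icy tr x * phi (x, 0))
        - nu * \int[surf_t]_(p in Sig) ((eu p - R_bcy tr p) * dn phi p) &
      forall phi, C21 setT phi -> (forall x, Om x -> phi (x, 0) = 0) ->
        \int[leb_t]_(p in Q)
           (el p * (pd None phi p - nu * lap phi p + a p * phi p)
            + (kappa p + 1) * ey p * phi p)
        + \int[leb]_(x in Om) (R_Tl tr x * phi (x, T))
        + \int[surf_t]_(p in Sig) ((alpha * eu p + R_u tr p) * phi p)
        - nu * \int[surf_t]_(p in Sig) (R_bcl tr p * dn phi p) =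
        \int[leb_t]_(p in Q) (Fl p * phi p)].

Definition M_a (y : st -> R) : R := fine (Linf leb_t Q (fun p => f' (y p))).

Definition kappa (y l : st -> R) : st -> R := fun p => f'' (y p) * l p.

Definition M_kappa (y l : st -> R) : R :=
  sup [set `|kappa y l p| | p in Qbar].

Definition alpha_0 (y l : st -> R) (C2 C3 : R) : R :=
  4 * Num.sqrt 2 * nu * (1 + M_kappa y l) * Num.sqrt C2 * C3.

(* [C] and [C'] are stability constants for the linear error system of [tr]. *)
Definition stability_constants (y l : st -> R) (tr : triple) (C C' M : R) : Prop :=
  forall Fy Fl ey el G eu,
    in_L2 leb_t Q Fy -> in_L2 leb_t Q Fl ->
    linear_error_system tr (fun p => f' (y p)) (kappa y l) Fy Fl ey el G eu ->
    (error_norm ey el G eu <= stab_rhs tr C C' M Fy Fl)%E.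

Definition e_y (y : st -> R) (tr : triple) : st -> R :=
  y \- realize (netY tr).
Definition e_l (l : st -> R) (tr : triple) : st -> R :=
  l \- realize (netL tr).
Definition e_u (u : st -> R) (tr : triple) : st -> R :=
  u \- realize (netU tr).

Definition triple_error (y u l : st -> R) (tr : triple) : \bar R :=
  error_norm (e_y y tr) (e_l l tr) (fun i => pd (Some i) (e_l l tr)) (e_u u tr).

Definition neighborhood (y l : st -> R) (tr : triple) (rho : R) : Prop :=
  (Linf leb_t Q (e_y y tr) + Linf leb_t Q (e_l l tr) <= rho%:E)%E.

Definition lipschitz_range (y : st -> R) (trs : nat -> triple) (lo hi : R) : Prop :=
  [/\ forall p, Qbar p -> lo <= y p <= hi,
      forall N p, Qbar p -> lo <= realize (netY (trs N)) p <= hi &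
      exists K : R, forall s t, lo <= s <= hi -> lo <= t <= hi ->
        `|f'' s - f'' t| <= K * `|s - t|].

(* [cY], [cL], [cU] are the network classes and [ut] the extension of [u]. *)
Definition approximable (y ut l : st -> R)
    (cY cL cU : nat -> set (mlp R (m.+1 + 1))) : Prop :=
  exists2 eps : nat -> R, eps @ \oo --> 0 & forall N,
    (ereal_inf [set z | exists tr : triple,
       [/\ cY N (netY tr), cL N (netL tr), cU N (netU tr) &
        z = sobolev_inf 2 Q (y \- realize (netY tr))%R
            + sobolev_inf 2 Q (l \- realize (netL tr))%R
            + sobolev_inf 1 Q (ut \- realize (netU tr))%R]] <= (eps N)%:E)%E.

End control_problem.

Definition borel (X : topologicalType) : set (set X) := <<s @open X >>.

Section sampling.
Context (R : realType) dT (TT : measurableType dT) (P : probability TT R).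

(* The probability of [E] is at least [p]; [E] need not be measurable. *)
Definition prob_ge (E : set TT) (p : R) : Prop :=
  exists A : set TT, [/\ measurable A, A `<=` E & (p%:E <= P A)%E].

Definition mutually_independent (X : topologicalType) n (xi : 'I_n -> TT -> X) : Prop :=
  forall B : 'I_n -> set X, (forall k, borel (B k)) ->
    P (\bigcap_k (xi k @^-1` B k)) = (\prod_(k < n) P (xi k @^-1` B k))%E.

(* The law of [xi] has the density [q] with respect to the restriction of [mu]
   to [D]; [Bor] is the Borel sigma-algebra. *)
Definition has_density d (X : measurableType d) (mu : {measure set X -> \bar R})
    (Bor : set (set X)) (D : set X) (q : X -> R) (xi : TT -> X) : Prop :=
  forall B, Bor B -> measurable (xi @^-1` B) /\
    P (xi @^-1` B) = (\int[mu]_(x in D `&` B) (q x)%:E)%E.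

Definition bounded_density d (X : measurableType d) (D : set X) (q : X -> R) : Prop :=
  measurable_fun D q /\
  exists lo hi : R, 0 < lo /\ forall x, D x -> lo <= q x <= hi.

End sampling.

Section verification.
Context (R : realType) (m : nat) (pb : problem R m).
Context dT (TT : measurableType dT) (P : probability TT R).
Local Notation pt := 'rV[R]_m.+1.
Local Notation st := ('rV[R]_m.+1 * R)%type.
Local Notation Om := (dom pb).
Local Notation T := (horizon pb).

(* The weights may depend on the sample. *)
Record verification_set := VerificationSet {
  N_int : nat; N_bc : nat; N_ic : nat; N_T : nat;
  q_int : 'I_N_int -> TT -> st;  w_int : 'I_N_int -> TT -> R;
  s_bc : 'I_N_bc -> TT -> st;    w_bc : 'I_N_bc -> TT -> R;
  x_ic : 'I_N_ic -> TT -> pt;    w_ic : 'I_N_ic -> TT -> R;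
  x_T : 'I_N_T -> TT -> pt;      w_T : 'I_N_T -> TT -> R }.

Definition normalized_weights n (w : 'I_n -> TT -> R) : Prop :=
  (forall k t, 0 < w k t) /\ forall t, \sum_(k < n) w k t = 1.

Definition iid_interior n (q : 'I_n -> TT -> st) : Prop :=
  mutually_independent P q /\ (forall k t, Q pb (q k t)) /\
  exists dens : st -> R,
    bounded_density (Q pb : set (caratheodory_type (@lebesgue_outer R m)
                                 * measurableTypeR R)) dens /\
    forall k, has_density P leb_t (@borel st) (Q pb) dens (q k).

Definition iid_spatial n (x : 'I_n -> TT -> pt) : Prop :=
  mutually_independent P x /\ (forall k t, Om (x k t)) /\
  exists dens : pt -> R,
    bounded_density (Om : set (caratheodory_type (@lebesgue_outer R m))) dens /\
    forall k, has_density P leb (@borel pt) Om dens (x k).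

(* [comp k] is the connected component of the boundary from which the k-th
   boundary point is drawn; every component is sampled. *)
Definition componentwise_boundary n (s : 'I_n -> TT -> st) : Prop :=
  mutually_independent P s /\
  exists (comp : 'I_n -> set pt) (dens : set pt -> st -> R),
    [/\ forall k, exists2 x, bdry Om x & comp k = connected_component (bdry Om) x,
        forall x, bdry Om x -> exists k, comp k x,
        forall k t, cyl (comp k) T (s k t),
        forall k, bounded_density
          (cyl (comp k) T : set (caratheodory_type (@hausdorff_outer R m.+1 m)
                                 * measurableTypeR R)) (dens (comp k)) &
        forall k, has_density P surf_t (@borel st) (cyl (comp k) T)
                    (dens (comp k)) (s k)].

Definition space_filling (V : verification_set) : Prop :=
  [/\ iid_interior (@q_int V), componentwise_boundary (@s_bc V),
      iid_spatial (@x_ic V) & iid_spatial (@x_T V)].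

Definition weights_ok (V : verification_set) : Prop :=
  [/\ normalized_weights (@w_int V), normalized_weights (@w_bc V),
      normalized_weights (@w_ic V) & normalized_weights (@w_T V)].

Inductive residual := Res_y | Res_l | Res_u | Bc_y | Bc_l | Ic_y | Tm_l.

Definition residuals : seq residual :=
  [:: Res_y; Res_l; Res_u; Bc_y; Bc_l; Ic_y; Tm_l].

Definition sample_size (V : verification_set) (r : residual) : nat :=
  match r with
  | Res_y | Res_l => N_int V
  | Res_u | Bc_y | Bc_l => N_bc V
  | Ic_y => N_ic V
  | Tm_l => N_T V
  end.

Definition res_dim (r : residual) : nat :=
  match r with Res_y | Res_l => m.+2 | _ => m.+1 end.

Definition quadrature X n (w : 'I_n -> TT -> R) (x : 'I_n -> TT -> X)
    (v : X -> R) (t : TT) : R :=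
  \sum_(k < n) w k t * v (x k t) ^+ 2.

Definition empirical (tr : triple R m) (V : verification_set) (r : residual)
    : TT -> R :=
  match r with
  | Res_y => quadrature (@w_int V) (@q_int V) (R_y pb tr)
  | Res_l => quadrature (@w_int V) (@q_int V) (R_l pb tr)
  | Res_u => quadrature (@w_bc V) (@s_bc V) (R_u pb tr)
  | Bc_y => quadrature (@w_bc V) (@s_bc V) (R_bcy tr)
  | Bc_l => quadrature (@w_bc V) (@s_bc V) (R_bcl tr)
  | Ic_y => quadrature (@w_ic V) (@x_ic V) (R_icy pb tr)
  | Tm_l => quadrature (@w_T V) (@x_T V) (R_Tl pb tr)
  end.

Definition average (tr : triple R m) (r : residual) : \bar R :=
  match r with
  | Res_y => sqL2av leb_t (Q pb) (R_y pb tr)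
  | Res_l => sqL2av leb_t (Q pb) (R_l pb tr)
  | Res_u => sqL2av surf_t (Sig pb) (R_u pb tr)
  | Bc_y => sqL2av surf_t (Sig pb) (R_bcy tr)
  | Bc_l => sqL2av surf_t (Sig pb) (R_bcl tr)
  | Ic_y => sqL2av leb Om (R_icy pb tr)
  | Tm_l => sqL2av leb Om (R_Tl pb tr)
  end.

Definition holder_exponent (tr : triple R m) (r : residual) (b : R) : Prop :=
  0 < b <= 1 /\
  (match r with
   | Res_y => holder_seminorm (@stdist R _) b (Q pb) (R_y pb tr)
   | Res_l => holder_seminorm (@stdist R _) b (Q pb) (R_l pb tr)
   | Res_u => holder_seminorm (@stdist R _) b (Sig pb) (R_u pb tr)
   | Bc_y => holder_seminorm (@stdist R _) b (Sig pb) (R_bcy tr)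
   | Bc_l => holder_seminorm (@stdist R _) b (Sig pb) (R_bcl tr)
   | Ic_y => holder_seminorm (@sdist R _) b Om (R_icy pb tr)
   | Tm_l => holder_seminorm (@sdist R _) b Om (R_Tl pb tr)
   end < +oo)%E.

Definition eta (tr : triple R m) (V : verification_set) (t : TT) : R :=
  Num.sqrt
   (\sum_(k < N_int V) w_int k t *
       (R_y pb tr (q_int k t) ^+ 2 + R_l pb tr (q_int k t) ^+ 2)
    + \sum_(k < N_bc V) w_bc k t *
       (R_u pb tr (s_bc k t) ^+ 2 + R_bcy tr (s_bc k t) ^+ 2
        + R_bcl tr (s_bc k t) ^+ 2)
    + \sum_(k < N_ic V) w_ic k t * R_icy pb tr (x_ic k t) ^+ 2
    + \sum_(k < N_T V) w_T k t * R_Tl pb tr (x_T k t) ^+ 2).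

Definition failure (n : nat) : R :=
  Num.sqrt n%:R * (1 - (Num.sqrt n%:R)^-1) ^+ n.

Definition quad_term (V : verification_set) (bexp C' : residual -> R) (r : residual) : R :=
  C' r * (sample_size V r)%:R `^ (- (bexp r / (res_dim r)%:R)).

(* The constant [C' r] may depend on the residual through its Hoelder seminorm. *)
Definition quadrature_constants (tr : triple R m) (V : verification_set)
    (bexp : residual -> R) (C : nat -> R) (C' : residual -> R) : Prop :=
  [/\ forall r, holder_exponent tr r (bexp r),
      exists K : R, forall n, (0 < n)%N -> 0 <= C n <= K * Num.sqrt n%:R,
      forall r, 0 <= C' r &
      forall r, prob_ge P
        [set t | (average tr r <= (C (sample_size V r) * empirical tr V r t
                                   + quad_term V bexp C' r)%:E)%E]
        (1 - failure (sample_size V r))].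

Definition E_quad (V : verification_set) (bexp C' : residual -> R) : R :=
  Num.sqrt (\sum_(r <- residuals) quad_term V bexp C' r).

Definition C_ver (V : verification_set) (C : nat -> R) : R :=
  \big[Num.max/0]_(r <- residuals) Num.sqrt (C (sample_size V r)).

End verification.

(* Main.v *)
Require Import Defs.
From mathcomp Require Import all_boot all_order all_algebra.
From mathcomp Require Import all_classical all_reals all_analysis.
From mathcomp Require Import measurable_realfun ring lra.

Set Implicit Arguments.
Unset Strict Implicit.
Unset Printing Implicit Defensive.

Import Order.TTheory GRing.Theory Num.Theory.
Import numFieldNormedType.Exports.

Local Open Scope classical_set_scope.
Local Open Scope ring_scope.

(** The trained triple lies in the neighbourhood of radius [rho] of the
    reference point, so that the nonlinear stability estimate applies to it: the
    error is at most [2 * Cstab] times a sum of five L^2 norms of residuals, plus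
    [2 * Cstab' * Mbc].  Everything else is the passage from these exact norms to
    their empirical counterparts.

    Each residual satisfies its quadrature inequality outside an event of
    probability at most [failure n], and a union bound ([prob_ge_bigsetI]) gives a
    common event on which the seven inequalities hold, whence the sum of the
    failure probabilities.  On it the
    averaged square of a residual is at most [C n * L + q], with [L] its empirical
    value and [q] its covering term.  As [L <= eta ^ 2] and [q <= E_quad ^ 2], the
    subadditivity of the square root yields [C_ver * eta + E_quad]
    ([sqrt_quadrature_bound]).

    The quadrature inequality concerns averages over the domain of the residual,
    the stability estimate concerns plain L^2 norms.  The factor between the two is
    the square root of the measure of the domain, and the constant [K] is
    assembled from these roots ([L2_le_average]).  The conversion makes sense only
    if the measures are finite, and this is where geometry enters:
    - the domain is bounded, hence of finite Lebesgue measure;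
    - its boundary is covered by finitely many charts, in each of which it is
      the graph of a function with bounded partial derivatives over a ball.  Such
      a function is Lipschitz ([eball_lipschitz]), so that a grid of [N ^ m]
      cells of side of order [1 / N] in the ball cuts the graph into [N ^ m] pieces
      of diameter of order [1 / N], and the m-dimensional Hausdorff measure is
      finite ([hausdorff_chart_graph]);
    - the cylinders over these sets then have finite product measure
      ([cylinder_fin]).

    The integrals over these sets are estimated directly from the definition of
    the integral of a nonnegative function as a supremum over simple functions
    ([integral_ge0_le]), which dispenses with a proof that the sets are
    measurable. *)

(** * Integrals over sets that need not be measurable *)

Section integrals_without_measurability.
Context d (X : measurableType d) (R : realType) (mu : {measure set X -> \bar R}).
Local Open Scope ereal_scope.
Import HBNNSimple.

Lemma le_integral_ge0 (f g : X -> \bar R) :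
  (forall x, 0 <= f x) -> (forall x, f x <= g x) ->
  \int[mu]_x f x <= \int[mu]_x g x.
Proof.
move=> f0 fg; have g0 x : 0 <= g x by exact: le_trans (fg x).
rewrite !ge0_integralTE//; apply: ge_ereal_sup => _ [h hf <-].
by apply: ereal_sup_ubound; exists h => // x; exact: le_trans (hf x) (fg x).
Qed.

(** A simple function below [f \_ D] is supported in a measurable subset of [D],
    so a bound on the integral over [D] may be tested on such subsets. *)
Lemma integral_ge0_le (D : set X) (f : X -> \bar R) (c : \bar R) :
  (forall x, D x -> 0 <= f x) ->
  (forall A (h : {nnsfun X >-> R}), measurable A -> A `<=` D ->
     (forall x, A x -> (h x)%:E <= f x) -> \int[mu]_(x in A) (h x)%:E <= c) ->
  \int[mu]_(x in D) f x <= c.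
Proof.
move=> f0 H; rewrite ge0_integralE//; apply: ge_ereal_sup => _ [h hf <-].
have AD : h @^-1` (~` [set 0%R]) `<=` D.
  move=> x /= hx; apply: contrapT => nDx; have := hf x.
  rewrite /patch ifF; last by apply/negbTE; rewrite notin_setE.
  rewrite lee_fin => h0; apply: hx; apply/eqP; rewrite eq_le h0/=.
  exact: fun_ge0.
have mA : measurable (h @^-1` (~` [set 0%R])).
  by rewrite -preimage_setC; apply: measurableC; exact: measurable_sfunP.
apply: (le_trans _ (H _ h mA AD _)); last first.
  by move=> x Ax; have := hf x; rewrite /patch mem_set//; exact: AD.
rewrite -integralT_nnsfun [leRHS]integral_mkcond; apply: le_integral_ge0.
  by move=> x; rewrite lee_fin fun_ge0.
move=> x; rewrite /patch; case: ifPn => //; rewrite notin_setE/= => hx.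
by rewrite (contrapT hx).
Qed.

(** Quantifying over the measurable subsets of [D] makes this applicable to a
    nonmeasurable [D], where [mu D = 0] alone says nothing about them. *)
Lemma integral_inner_null (D : set X) (f : X -> \bar R) :
  (forall x, D x -> 0 <= f x) ->
  (forall A, measurable A -> A `<=` D -> mu A = 0) ->
  \int[mu]_(x in D) f x = 0.
Proof.
move=> f0 D0; apply/eqP; rewrite eq_le integral_ge0// andbT.
apply: integral_ge0_le => // A h mA AD _; rewrite null_set_integral//; last exact: D0.
exact/measurable_EFinP/measurable_funTS.
Qed.

Lemma integral_le_inner (D : set X) (f : X -> \bar R) (M : R) (c : \bar R) :
  (0 <= M)%R -> (forall x, D x -> 0 <= f x <= M%:E) ->
  (forall A, measurable A -> A `<=` D -> mu A <= c) ->
  \int[mu]_(x in D) f x <= M%:E * c.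
Proof.
move=> M0 f0 Dc; apply: integral_ge0_le => [x /f0/andP[]//|A h mA AD hf].
apply: (@le_trans _ _ (\int[mu]_(x in A) (cst M%:E) x)).
  apply: ge0_le_integral => //.
  - by move=> x _; rewrite lee_fin fun_ge0.
  - exact/measurable_EFinP/measurable_funTS.
  - by move=> x Ax; apply: le_trans (hf x Ax) _; case/andP: (f0 x (AD x Ax)).
by rewrite integral_cst// lee_pmul//; exact: Dc.
Qed.

End integrals_without_measurability.

(** * Space-time cylinders *)

Section cylinder.
Context (R : realType) (X : pointedType) (mu : {outer_measure set X -> \bar R}).
Local Open Scope ereal_scope.

Local Notation mc := (mu : {measure set (caratheodory_type mu) -> \bar R}).
Local Notation cylm :=
  ((mc \x (@lebesgue_measure R)) : {measure set (caratheodory_type mu * measurableTypeR R) -> \bar R}).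

Lemma cylinder_section (D : set X) (T : R) x :
  (0 < T)%R -> (@lebesgue_measure R) (xsection (D `*` [set t | (0 < t < T)%R]) x)
   = (if x \in D then T%:E else 0).
Proof.
move=> T0; case: ifPn => xD; last by rewrite notin_xsectionX.
rewrite in_xsectionX//.
have -> : [set t : R | (0 < t < T)%R] = [set` `]0%R, T[].
  by apply/seteqP; split=> t /=; rewrite in_itv.
by rewrite lebesgue_measure_itv/= lte_fin T0 oppr0 adde0.
Qed.

(** The product measure of the cylinder is by definition the integral of the
    lengths of its sections, that is, of [T] over [D]. *)
Lemma cylinder_fin (D : set X) (T : R) : (0 < T)%R -> mu D < +oo ->
  cylm (D `*` [set t | (0 < t < T)%R]) < +oo.
Proof.
move=> T0 Doo; apply: (@le_lt_trans _ _ (T%:E * mu D)); last first.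
  by rewrite lte_mul_pinfty// ?lee_fin// ltW.
have -> : cylm (D `*` [set t | (0 < t < T)%R]) = \int[mc]_(x in D) (cst T%:E) x.
  rewrite [RHS]integral_mkcond; apply: eq_integral => x _.
  exact: cylinder_section.
apply: integral_le_inner; first exact: ltW.
  by move=> x _; rewrite lee_fin ltW//= lexx.
by move=> A _ AD; exact: le_outer_measure.
Qed.

(** Monotonicity of a measure between two measurable sets does not apply when [D]
    is arbitrary; it is recovered here because the sections of the cylinder are
    intervals. *)
Lemma cylinder_monotone (D : set X) (T : R) A : (0 < T)%R ->
  A `<=` D `*` [set t | (0 < t < T)%R] -> measurable (A : set (caratheodory_type mu * measurableTypeR R)) ->
  cylm A <= cylm (D `*` [set t | (0 < t < T)%R]).
Proof.
move=> T0 AD mA; apply: le_integral_ge0 => // x.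
apply: le_measure; rewrite ?inE.
- exact: measurable_xsection.
- have [xD|xD] := boolP (x \in D); last by rewrite notin_xsectionX.
  rewrite in_xsectionX//.
  have -> : [set t : R | (0 < t < T)%R] = [set` `]0%R, T[].
    by apply/seteqP; split=> t /=; rewrite in_itv.
  exact: measurable_itv.
- exact: le_xsection.
Qed.

End cylinder.

(** * From averages to L^2 norms *)

Section averages.
Context (R : realType) d (X : measurableType d) (mu : {measure set X -> \bar R}).
Local Open Scope ereal_scope.

(** When [mu D = 0] the average is [+oo * 0 = 0] and carries no information; the
    inequality then holds because the integral over a null set vanishes. *)
Lemma L2_le_average (D : set X) (v : X -> R) (e : R) :
  mu D < +oo -> (forall A, measurable A -> A `<=` D -> mu A <= mu D) ->
  sqL2av mu D v <= e%:E ->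
  L2 mu D v <= (Num.sqrt (fine (mu D)) * Num.sqrt e)%:E.
Proof.
move=> Doo mD.
have v0 : forall x, D x -> 0 <= ((v x) ^+ 2)%:E by move=> x _; rewrite lee_fin sqr_ge0.
have s0 : 0 <= sqL2 mu D v by exact: integral_ge0.
have [D0|Dn0] := eqVneq (mu D) 0.
  move=> _; rewrite /L2 /sqL2 integral_inner_null//.
    by rewrite sqrte0 lee_fin mulr_ge0 ?sqrtr_ge0.
  move=> A mA AD; apply/eqP; rewrite eq_le measure_ge0 andbT.
  by rewrite (le_trans (mD A mA AD))// D0.
have Df : mu D \is a fin_num by rewrite ge0_fin_numE.
have r0 : (0 < fine (mu D))%R.
  by apply: fine_gt0; rewrite lt0e Dn0 measure_ge0.
rewrite /sqL2av /L2; move: (fine (mu D)) (fineK Df) r0 => k <- r0.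
rewrite inver (gt_eqF r0) => H.
have e0 : (0 <= e)%R.
  by rewrite -lee_fin (le_trans _ H)// mule_ge0// lee_fin invr_ge0 ltW.
rewrite -sqrtrM; last exact: ltW.
rewrite -[leRHS]/(sqrte (k * e)%:E).
rewrite lee_sqrt ?lee_fin ?mulr_ge0 ?(ltW r0)//.
by rewrite EFinM -lee_pdivrMl.
Qed.

Lemma L2N (D : set X) (v : X -> R) : L2 mu D (\- v)%R = L2 mu D v.
Proof. by congr sqrte; apply: eq_integral => x _; rewrite sqrrN. Qed.

End averages.

(** * Lipschitz continuity from bounded partial derivatives *)

Section lipschitz_on_balls.
Context (R : realType) (n : nat).
Implicit Types (x y z c : 'rV[R]_n) (v : 'rV[R]_n -> R).
Local Notation e i := (delta_mx ord0 i : 'rV[R]_n).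

Lemma is_derive_line v x i (s : R) : derivable v (x + s *: e i) (e i) ->
  is_derive s 1 (fun u => v (x + u *: e i)) (spd i v (x + s *: e i)).
Proof.
have E : (fun h : R => h^-1 *: (((fun u => v (x + u *: e i)) \o shift s) (h *: 1)
            - v (x + s *: e i))) =
         (fun h => h^-1 *: ((v \o shift (x + s *: e i)) (h *: e i) - v (x + s *: e i))).
  apply/funext => h /=; congr (_ *: (v _ - _)).
  by rewrite [h *: 1]mulr1 scalerDl addrCA.
move=> dv; apply: DeriveDef; first by rewrite /derivable E.
by rewrite /spd /derive E.
Qed.

Lemma axis_step_ge0 (D : set 'rV[R]_n) v (M : R) i x (t : R) : 0 <= t ->
  (forall y, D y -> derivable v y (e i) /\ `|spd i v y| <= M) ->
  (forall s, 0 <= s <= t -> D (x + s *: e i)) ->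
  `|v (x + t *: e i) - v x| <= M * t.
Proof.
move=> t0 vD xD.
have dl s : 0 <= s <= t -> is_derive s 1 (fun u => v (x + u *: e i)) (spd i v (x + s *: e i)).
  by move=> /xD /vD[+ _]; exact: is_derive_line.
have [||c] := MVT_segment t0 (f := fun u => v (x + u *: e i)) (df := fun s => spd i v (x + s *: e i)).
- by move=> s; rewrite in_itv/= => /andP[/ltW s0 /ltW st]; apply: dl; rewrite s0.
- apply: derivable_within_continuous => s; rewrite in_itv/= => /dl st.
  exact: ex_derive.
rewrite in_itv/= scale0r addr0 subr0 => /xD /vD[_ cM] ->.
by rewrite normrM (ger0_norm t0) ler_wpM2r.
Qed.

Lemma axis_step (D : set 'rV[R]_n) v (M : R) i x (t : R) :
  (forall y, D y -> derivable v y (e i) /\ `|spd i v y| <= M) ->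
  (forall s, 0 <= s <= 1 -> D (x + (s * t) *: e i)) ->
  `|v (x + t *: e i) - v x| <= M * `|t|.
Proof.
move=> vD xD; have [t0|t0] := leP 0 t.
  rewrite (ger0_norm t0); apply: (axis_step_ge0 _ vD) => // s /andP[s0 st].
  have [t00|tn0] := eqVneq t 0.
    have := xD 0; rewrite mul0r lexx ler01 => /(_ isT).
    by rewrite (_ : s = 0)//; apply/eqP; rewrite eq_le s0 -t00 st.
  have := xD (s / t); rewrite divfK// divr_ge0//= ler_pdivrMr ?mul1r; last by rewrite lt0r tn0.
  exact.
rewrite distrC.
have -> : v x = v ((x + t *: e i) + (- t) *: e i) by rewrite -addrA -scalerDl subrr scale0r addr0.
rewrite (ltr0_norm t0); apply: (axis_step_ge0 _ vD); rewrite ?oppr_ge0 ?ltW// => s /andP[s0 st].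
have := xD ((t + s) / t); rewrite divfK ?lt_eqF// -addrA -scalerDl; apply.
rewrite -mulrNN -invrN; apply/andP; split.
  by rewrite divr_ge0// ?oppr_ge0 ?(ltW t0)// addrC -lerBrDr sub0r.
by rewrite ler_pdivrMr ?oppr_gt0// mul1r lerN2 lerDl.
Qed.

(** Balls are stable under moving coordinates towards those of the centre.  This is
    what keeps the axis-parallel paths below inside the ball. *)
Lemma eball_closer (c : 'rV[R]_n) (r : R) x z : eball c r x ->
  (forall i, `|z ord0 i - c ord0 i| <= `|x ord0 i - c ord0 i|) -> eball c r z.
Proof.
rewrite /eball/= /enorm => xr zx; apply: le_lt_trans xr.
rewrite ler_sqrt ?sumr_ge0//; last by move=> i _; rewrite sqr_ge0.
apply: ler_sum => i _; rewrite !mxE -[leLHS]real_normK ?num_real//.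
by rewrite -[leRHS]real_normK ?num_real// lerXn2r ?nnegrE.
Qed.

(* The axis-parallel path from [x] to [z], one coordinate at a time. *)
Let mix x z (k : nat) : 'rV[R]_n :=
  \row_i (if (i < k)%N then z ord0 i else x ord0 i).

(** The mean value theorem on each edge of the axis-parallel path from [x] to [z]. *)
Lemma eball_inward_lipschitz c (r : R) v (M B : R) x z : 0 <= M ->
  (forall i y, eball c r y -> derivable v y (e i) /\ `|spd i v y| <= M) ->
  eball c r x ->
  (forall i, `|z ord0 i - c ord0 i| <= `|x ord0 i - c ord0 i|) ->
  (forall i, `|x ord0 i - z ord0 i| <= B) ->
  `|v x - v z| <= n%:R * (M * B).
Proof.
move=> M0 vM xr zx xzB.
suff H k : (k <= n)%N -> `|v x - v (mix x z k)| <= k%:R * (M * B).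
  have -> : z = mix x z n by apply/rowP => i; rewrite mxE ltn_ord.
  exact: H.
elim: k => [_|k IH kn].
  have -> : mix x z 0 = x by apply/rowP => i; rewrite mxE.
  by rewrite subrr normr0 mul0r.
have := ler_distD (v (mix x z k)) (v x) (v (mix x z k.+1)).
move=> /le_trans; apply; rewrite -natr1 mulrDl mul1r.
apply: lerD; first exact/IH/ltnW.
rewrite distrC.
pose i := Ordinal kn; pose t := z ord0 i - x ord0 i.
have mixS : mix x z k.+1 = mix x z k + t *: e i.
  apply/rowP => j; rewrite !mxE eqxx/= ltnS leq_eqVlt.
  have [ji|ji] := eqVneq j i.
    by rewrite ji eqxx/= ltnn /t mulr1 addrC subrK.
  have /negbTE -> : nat_of_ord j != k by apply: contra ji => /eqP jk; apply/eqP/val_inj.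
  by rewrite /= mulr0 addr0.
rewrite mixS; apply: (le_trans (axis_step (D := eball c r) (M := M) (vM i) _)).
  move=> s /andP[s0 s1]; apply: (eball_closer xr) => j; rewrite !mxE eqxx/=.
  have [ji|ji] := eqVneq j i; last by rewrite mulr0 addr0; case: ifP.
  rewrite ji ltnn /= mulr1 /t.
  (* the edge stays in the ball by convexity of the distance to the centre *)
  have -> : x ord0 i + s * (z ord0 i - x ord0 i) - c ord0 i =
    (1 - s) * (x ord0 i - c ord0 i) + s * (z ord0 i - c ord0 i).
    rewrite !mulrBr !mulrBl !mul1r; ring.
  apply: (le_trans (ler_normD _ _)); rewrite !normrM (ger0_norm s0) ger0_norm ?subr_ge0//.
  rewrite [leRHS](_ : _ = (1 - s) * `|x ord0 i - c ord0 i| + s * `|x ord0 i - c ord0 i|).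
    by rewrite lerD2l ler_wpM2l.
  by rewrite -mulrDl subrK mul1r.
by apply: ler_wpM2l => //; rewrite /t distrC.
Qed.

(** Partial derivatives control [v] only along the axes, and an axis-parallel path
    from [x] to [y] may leave the ball.  The path goes instead through the point
    [z] whose every coordinate is that of [x] or [y], whichever is closer to the
    centre: both halves, traversed towards [z], move inward. *)
Lemma eball_lipschitz c (r : R) v (M B : R) x y : 0 <= M ->
  (forall i p, eball c r p -> derivable v p (e i) /\ `|spd i v p| <= M) ->
  eball c r x -> eball c r y ->
  (forall i, `|x ord0 i - y ord0 i| <= B) ->
  `|v x - v y| <= 2 * (n%:R * (M * B)).
Proof.
move=> M0 vM xr yr xyB.
pose z : 'rV[R]_n := \row_i
  (if `|x ord0 i - c ord0 i| <= `|y ord0 i - c ord0 i| then x ord0 i else y ord0 i).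
have zE i : z ord0 i = x ord0 i \/ z ord0 i = y ord0 i.
  by rewrite mxE; case: ifP; [left|right].
have B0 (i : 'I_n) : 0 <= B by apply: le_trans (xyB i).
have := ler_distD (v z) (v x) (v y).
move=> /le_trans; apply; rewrite [2]mulr2n mulrDl mul1r; apply: lerD.
  apply: (eball_inward_lipschitz M0 vM xr) => i.
    by rewrite mxE; case: ifP => // /negbT; rewrite -ltNge => /ltW.
  by case: (zE i) => ->//; rewrite subrr normr0 (B0 i).
rewrite distrC; apply: (eball_inward_lipschitz M0 vM yr) => i.
  by rewrite mxE; case: ifP.
by case: (zE i) => ->//; rewrite ?subrr ?normr0 ?(B0 i)// distrC.
Qed.

End lipschitz_on_balls.

(** * Finiteness of the Hausdorff measure of a graph *)

Section finite_covers.
Context (R : realType) (X : pointedType).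
Local Open Scope ereal_scope.

(** The cover is made countable by padding it with empty sets. *)
Lemma cover_measure_le_sum (I : finType) (w : set X -> \bar R) (F : I -> set X)
    (A : set X) :
  w set0 = 0 -> (forall B, 0 <= w B) -> A `<=` \bigcup_i F i ->
  cover_measure w A <= \sum_i w (F i).
Proof.
move=> w0 wge0 AF; pose s := [seq F i | i <- enum I].
have -> : \sum_i w (F i) = \sum_(0 <= k <oo) w (nth set0 s k).
  rewrite (nneseries_split 0 (size s)) => [|//].
  rewrite eseries0 ?adde0 ?add0n => [|k /= sk _]; last by rewrite nth_default.
  by rewrite -[in LHS]big_enum -(big_map F xpredT w) (big_nth set0).
apply: ereal_inf_lbound; exists (nth set0 s) => //; split=> [k|x Ax].
  exact: sub_sigma_algebra.
have [i _ Fix] := AF x Ax; exists (index i (enum I)) => //.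
by rewrite (nth_map i) ?index_mem ?mem_enum// nth_index ?mem_enum.
Qed.

End finite_covers.

Section euclidean_norm.
Context (R : realType) (n : nat).
Implicit Types x y : 'rV[R]_n.

Lemma enorm_ge0 x : 0 <= enorm x. Proof. exact: sqrtr_ge0. Qed.

Lemma coord_le_enorm x i : `|x ord0 i| <= enorm x.
Proof.
rewrite -sqrtr_sqr ler_sqrt ?sumr_ge0// => [|j _]; last exact: sqr_ge0.
by rewrite (bigD1 i)//= lerDl sumr_ge0// => j _; exact: sqr_ge0.
Qed.

Lemma enorm_le_coord x (B : R) : 0 <= B -> (forall i, `|x ord0 i| <= B) ->
  enorm x <= n%:R * B.
Proof.
move=> B0 xB; rewrite -(ger0_norm (mulr_ge0 (ler0n R n) B0)) -sqrtr_sqr.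
rewrite ler_sqrt ?sqr_ge0//; apply: (@le_trans _ _ (\sum_(i < n) B ^+ 2)).
  apply: ler_sum => i _; rewrite -real_normK ?num_real//.
  by rewrite lerXn2r ?nnegrE.
rewrite sumr_const card_ord exprMn -[leLHS]mulr_natl ler_wpM2r ?sqr_ge0//.
by rewrite -natrX ler_nat; case: n => // k; rewrite leq_pmull.
Qed.

Lemma enorm_orthogonal x (A : 'M[R]_n) : A *m A^T = 1%:M ->
  enorm (x *m A) = enorm x.
Proof.
have E y : \sum_(i < n) y ord0 i ^+ 2 = (y *m y^T) ord0 ord0.
  by rewrite mxE; apply: eq_bigr => i _; rewrite mxE expr2.
move=> AA; rewrite /enorm !E trmx_mul mulmxA -(mulmxA x A) AA mulmx1.
by [].
Qed.

End euclidean_norm.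

Section hausdorff_of_graphs.
Context (R : realType) (m : nat).
Implicit Types (c : chart R m) (x : 'rV[R]_m.+1).

Definition chart_graph c : set 'rV[R]_m.+1 :=
  [set x | eball (Defs.center c) (Defs.radius c) (base c x) /\ top c x = height c (base c x)].

(** The frame is orthogonal, so distances may be read in the rotated coordinates. *)
Lemma chart_graph_dist c x y (B C : R) :
  frame c *m (frame c)^T = 1%:M -> 0 <= B -> 0 <= C ->
  (forall j, `|base c x ord0 j - base c y ord0 j| <= B) ->
  `|top c x - top c y| <= C -> enorm (x - y) <= m.+1%:R * (B + C).
Proof.
move=> AA B0 C0 bB tC; rewrite -(enorm_orthogonal _ AA).
apply: enorm_le_coord => [|i]; first exact: addr_ge0.
rewrite mulmxBl !mxE; have [j ->|->] := unliftP ord_max i.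
  by have := bB j; rewrite !mxE => /le_trans; apply; rewrite lerDl.
by have := tC; rewrite /top !mxE => /le_trans; apply; rewrite lerDr.
Qed.

Lemma hausdorff_weight_le (delta D : R) (A : set 'rV[R]_m.+1) : 0 <= D -> D <= delta ->
  (forall x y, A x -> A y -> enorm (x - y) <= D) ->
  (hausdorff_weight m delta A <= (ball_volume R m / 2 ^+ m * D ^+ m)%:E)%E.
Proof.
move=> D0 Dd AD; have bv0 : 0 <= ball_volume R m / 2 ^+ m.
  by rewrite divr_ge0 ?ball_volume_ge0// exprn_ge0.
rewrite /hausdorff_weight; case: asboolP => [_|/eqP/set0P[x Ax]].
  by rewrite lee_fin mulr_ge0 ?exprn_ge0.
have dA : (ediam A <= D%:E)%E.
  by apply: ge_ereal_sup => _ [[y z] [/= Ay Az] <-]; rewrite lee_fin AD.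
have dA0 : (0 <= ediam A)%E.
  apply: (@le_trans _ _ (enorm (x - x))%:E); first by rewrite lee_fin enorm_ge0.
  by apply: ereal_sup_ubound; exists (x, x).
rewrite ifT; last by apply: (le_trans dA); rewrite lee_fin.
have dAf : ediam A \is a fin_num by rewrite ge0_fin_numE// (le_lt_trans dA)// ltry.
move: dA dA0; rewrite -(fineK dAf) -EFin_expe -EFinM !lee_fin => dA dA0.
by rewrite ler_wpM2l// lerXn2r ?nnegrE.
Qed.

(** With cells of side [s = 2 r / N] in the ball, the graph falls into [N ^ m]
    pieces of diameter at most [L * s].  Their weights add up to a multiple of
    [N ^ m * (L * s) ^ m = (2 r L) ^ m], which is independent of [N], while [N]
    is at disposal to make the diameters smaller than any [delta]. *)
Lemma hausdorff_chart_graph c (M : R) : 0 <= M ->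
  frame c *m (frame c)^T = 1%:M -> 0 < Defs.radius c ->
  (forall i p, eball (Defs.center c) (Defs.radius c) p ->
     derivable (height c) p (delta_mx ord0 i) /\ `|spd i (height c) p| <= M) ->
  (hausdorff_outer m (chart_graph c) < +oo)%E.
Proof.
move=> M0 AA r0 hM; set r := Defs.radius c in r0 *.
(* 1 for the base coordinates, [2 m M] for the height by [eball_lipschitz] *)
pose L : R := m.+1%:R * (1 + 2 * (m%:R * M)).
have L0 : 0 <= L by rewrite mulr_ge0// addr_ge0// mulr_ge0// mulr_ge0.
pose K : R := ball_volume R m / 2 ^+ m * (L * (2 * r)) ^+ m.
suff H : (hausdorff_outer m (chart_graph c) <= K%:E)%E by exact: le_lt_trans (ltry K).
apply: ge_ereal_sup => _ [delta d0 <-].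
pose N := Num.truncn (L * (2 * r) / delta); pose s : R := 2 * r / N.+1%:R.
have s0 : 0 < s by rewrite divr_gt0// mulr_gt0.
have Lsd : L * s <= delta.
  have -> : L * s = L * (2 * r) / N.+1%:R by rewrite /s !mulrA.
  rewrite ler_pdivrMr// [leRHS]mulrC -ler_pdivrMr//.
  have : 0 <= L * (2 * r) / delta by rewrite divr_ge0 ?(ltW d0)// mulr_ge0// mulr_ge0// ltW.
  by move=> /truncn_itv/andP[_ /ltW].
pose coord x (j : 'I_m) := (base c x ord0 j - (Defs.center c ord0 j - r)) / s.
have coord_itv x j : chart_graph c x -> 0 <= coord x j < N.+1%:R.
  move=> [xr _].
  have : `|base c x ord0 j - Defs.center c ord0 j| < r.
    apply: le_lt_trans xr; apply: le_trans (coord_le_enorm _ j).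
    by rewrite [leRHS](_ : _ = `|base c x ord0 j - Defs.center c ord0 j|)// !mxE.
  rewrite ltr_norml => /andP[h1 h2]; rewrite /coord; apply/andP; split.
    apply: divr_ge0; last exact: ltW.
    by lra.
  rewrite ltr_pdivrMr// /s mulrCA divff ?mulr1//; lra.
pose cell (k : {ffun 'I_m -> 'I_N.+1}) : set 'rV[R]_m.+1 :=
  [set x | chart_graph c x /\ forall j, (k j)%:R <= coord x j < (k j).+1%:R].
have cover : chart_graph c `<=` \bigcup_k cell k.
  move=> x Gx; exists [ffun j => inord (Num.truncn (coord x j))] => //.
  split=> // j; have /andP[c0 cN] := coord_itv x j Gx.
  by rewrite ffunE inordK ?truncn_itv// truncn_lt_nat.
have cellB k x y : cell k x -> cell k y -> enorm (x - y) <= L * s.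
  move=> [[xr xt] xk] [[yr yt] yk].
  have bs j : `|base c x ord0 j - base c y ord0 j| <= s.
    have /andP[x1 x2] := xk j; have /andP[y1 y2] := yk j.
    rewrite (_ : _ - _ = (coord x j - coord y j) * s); last first.
      by rewrite -mulrBl divfK ?gt_eqF//; ring.
    rewrite normrM (gtr0_norm s0) ler_piMl ?(ltW s0)//.
    move: x1 x2 y1 y2; rewrite -!natr1 => x1 x2 y1 y2.
    by rewrite ler_norml; apply/andP; split; lra.
  rewrite /L -mulrA mulrDl mul1r; apply: (chart_graph_dist AA) => //.
  - exact: ltW.
  - by rewrite !mulr_ge0// ltW.
  - rewrite xt yt -mulrA -mulrA; exact: (eball_lipschitz M0 hM).
apply: (le_trans (cover_measure_le_sum _ _ cover)).
- exact: hausdorff_weight0.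
- exact: hausdorff_weight_ge0.
apply: (@le_trans _ _ (\sum_(k : {ffun 'I_m -> 'I_N.+1})
    (ball_volume R m / 2 ^+ m * (L * s) ^+ m)%:E)%E).
  apply: lee_sum => k _; apply: hausdorff_weight_le => //.
    by rewrite mulr_ge0// ltW.
  exact: cellB.
rewrite sumEFin lee_fin sumr_const card_ffun !card_ord.
rewrite -[leLHS]mulr_natl natrX mulrCA -exprMn /K.
rewrite (_ : N.+1%:R * (L * s) = L * (2 * r))// /s mulrCA; congr (L * _).
by rewrite mulrCA mulfV ?mulr1// pnatr_eq0.
Qed.

End hausdorff_of_graphs.

(** * Bounds carried by the Hoelder norms *)

Section norm_bounds.
Context (R : realType).
Local Open Scope ereal_scope.

Lemma sup_norm_ge0 (X : Type) (D : set X) (v : X -> R) : D !=set0 -> 0 <= sup_norm D v.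
Proof.
move=> [x Dx]; apply: (@le_trans _ _ `|v x|%:E); first by rewrite lee_fin.
by apply: ereal_sup_ubound; exists x.
Qed.

Lemma holder_seminorm_ge0 (X : Type) (dist : X -> X -> R) (b : R) (D : set X)
  (v : X -> R) : D !=set0 -> 0 <= holder_seminorm dist b D v.
Proof.
move=> [x Dx]; apply: (@le_trans _ _ (`|v x - v x| / (dist x x `^ b))%:E).
  by rewrite subrr normr0 mul0r.
by apply: ereal_sup_ubound; exists (x, x).
Qed.

Context (n : nat).
Implicit Types (D : set 'rV[R]_n) (v : 'rV[R]_n -> R).

Let second_order_ge0 b D v : D !=set0 ->
  0 <= \sum_(i < n) \sum_(j < n) (sup_norm D (spd j (spd i v))
       + holder_seminorm (@sdist R n) b D (spd j (spd i v))).
Proof.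
move=> D0; do 2 (apply: sume_ge0 => ? _).
by rewrite adde_ge0 ?sup_norm_ge0 ?holder_seminorm_ge0.
Qed.

Lemma holder2_norm_ge0 b D v : D !=set0 -> 0 <= holder2_norm b D v.
Proof.
move=> D0; rewrite /holder2_norm !adde_ge0 ?second_order_ge0 ?sup_norm_ge0//.
by apply: sume_ge0 => i _; exact: sup_norm_ge0.
Qed.

Lemma holder2_le_spd b D v M i x : holder2_le b D v M -> D x ->
  (`|spd i v x| <= M)%R.
Proof.
move=> [_ vM] Dx; have D0 : D !=set0 by exists x.
rewrite -lee_fin (le_trans _ vM)// /holder2_norm.
apply: (@le_trans _ _ (sup_norm D (spd i v))); first by apply: ereal_sup_ubound; exists x.
apply: (@le_trans _ _ (\sum_(i < n) sup_norm D (spd i v))).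
  by rewrite (bigD1 i)//= leeDl// sume_ge0// => j _; exact: sup_norm_ge0.
rewrite -addeA addeCA leeDl// adde_ge0 ?second_order_ge0//; exact: sup_norm_ge0.
Qed.

End norm_bounds.

(** * Finiteness of the measures of the domain and its boundary *)

Section finite_measures.
Context (R : realType) (m : nat).
Local Open Scope ereal_scope.

Lemma outer_measure_finite_union (X : Type) (mu : {outer_measure set X -> \bar R})
    (I : finType) (F : I -> set X) (A : set X) :
  (forall i, mu (F i) < +oo) -> A `<=` \bigcup_i F i -> mu A < +oo.
Proof.
move=> Foo AF.
suff H (s : seq I) : mu [set x | exists2 i, i \in s & F i x] < +oo.
  apply: le_lt_trans (H (enum I)); apply: le_outer_measure => x /AF[i _ Fix].
  by exists i; rewrite ?mem_enum.
elim: s => [|i s IH].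
  rewrite (_ : [set _ | _] = set0) ?outer_measure0 ?ltry//.
  by apply/seteqP; split=> // x [].
apply: (@le_lt_trans _ _ (mu (F i) + mu [set x | exists2 i, i \in s & F i x])).
  apply: le_trans (outer_measureU2 _ _ _); apply: le_outer_measure => x [j].
  by rewrite inE => /orP[/eqP -> Fx|js Fx]; [left|right; exists j].
by rewrite lte_add_pinfty.
Qed.

Lemma hausdorff_bdry_fin (b : R) (D : set 'rV[R]_m.+1) k (atlas : 'I_k -> chart R m) :
  holder_domain b D atlas -> hausdorff_outer m (bdry D) < +oo.
Proof.
move=> [_ _ _ _ [charts cover]].
pose mu := (@hausdorff_outer R m.+1 m : {outer_measure set 'rV[R]_m.+1 -> \bar R}).
apply: (@outer_measure_finite_union _ mu _ (fun i => chart_graph (atlas i))).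
  move=> i; have [AA r0 _ [_ [M hM]] _] := charts i.
  have bM p : eball (Defs.center (atlas i)) (Defs.radius (atlas i)) p -> forall j,
      derivable (height (atlas i)) p (delta_mx ord0 j) /\
      (`|spd j (height (atlas i)) p| <= `|M|)%R.
    move=> pr j; split; first by have [/(_ p pr)[]] := hM.
    exact: le_trans (holder2_le_spd j hM pr) (ler_norm M).
  by apply: (hausdorff_chart_graph (normr_ge0 M)) => // j p /bM.
move=> x Dx; have [i xi] := cover x Dx; exists i => //.
have [_ _ _ _ /(_ x xi)[_ /iffLR/(_ Dx)]] := charts i.
by case: xi.
Qed.

Lemma lebesgue_bounded_fin (D : set 'rV[R]_m.+1) : bounded_set D ->
  lebesgue_outer D < +oo.
Proof.
move=> [M [_ /(_ (M + 1)%R)]]; rewrite ltrDl ltr01 => /(_ isT) DM.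
pose B := `|M + 1|%R.
pose a : 'rV[R]_m.+1 := const_mx (- B)%R; pose c : 'rV[R]_m.+1 := const_mx (B + 1)%R.
apply: (@le_lt_trans _ _ (\sum_(i < 1) box_volume (box a c))).
  apply: (@cover_measure_le_sum _ _ 'I_1 (@box_volume R m) (fun=> box a c)).
  - exact: box_volume0.
  - exact: box_volume_ge0.
  move=> x Dx; exists ord0 => // i; rewrite !mxE.
  have : (`|x ord0 i| <= B)%R.
    apply: le_trans (ler_norm (M + 1)%R).
    apply: le_trans (DM x Dx).
    by rewrite [leRHS]/Num.norm/= mx_normrE; apply/bigmax_geP; right; exists (ord0, i).
  by rewrite ler_norml => /andP[-> /le_lt_trans ->//]; rewrite ltrDl.
rewrite big_ord1; apply: (@le_lt_trans _ _ (\prod_i (c ord0 i - a ord0 i))%:E); last exact: ltry.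
apply: ereal_inf_lbound; exists a, c; split=> // i; rewrite !mxE.
have : (0 <= B)%R := normr_ge0 _; lra.
Qed.

End finite_measures.

(** * The union bound *)

Section union_bound.
Context (R : realType) dT (TT : measurableType dT) (P : probability TT R).

Lemma prob_ge_setI (E F : set TT) (p q : R) :
  prob_ge P E (1 - p) -> prob_ge P F (1 - q) -> prob_ge P (E `&` F) (1 - (p + q)).
Proof.
move=> [A [mA AE PA]] [B [mB BF PB]]; exists (A `&` B).
split; [exact: measurableI|exact: setISS|].
have : (P (~` (A `&` B)) <= P (~` A) + P (~` B))%E.
  by rewrite setCI; apply: measureU2; exact: measurableC.
rewrite !probability_setC//; last exact: measurableI.
have f G : measurable G -> P G \is a fin_num by move=> mG; exact: fin_num_measure.
move: PA PB; rewrite -(fineK (f _ mA)) -(fineK (f _ mB)).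
rewrite -(fineK (f _ (measurableI _ _ mA mB))) -!EFinB -EFinD !lee_fin; lra.
Qed.

Lemma prob_ge_bigsetI (I : Type) (s : seq I) (E : I -> set TT) (p : I -> R) :
  (forall i, prob_ge P (E i) (1 - p i)) ->
  prob_ge P (\big[setI/setT]_(i <- s) E i) (1 - \sum_(i <- s) p i).
Proof.
move=> H; elim: s => [|i s IH]; last by rewrite !big_cons; exact: prob_ge_setI.
by rewrite !big_nil subr0; exists setT; rewrite probability_setT.
Qed.

Lemma prob_ge_sub (E F : set TT) (p : R) : E `<=` F -> prob_ge P E p -> prob_ge P F p.
Proof. by move=> EF [A [mA AE PA]]; exists A; split=> //; exact: subset_trans EF. Qed.

End union_bound.

(** * The residual indicator *)

Section indicator.
Context (R : realType) (m : nat) (pb : problem R m).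
Context dT (TT : measurableType dT) (tr : triple R m) (V : verification_set R m TT).

Lemma sqrtrD_le (x y : R) : 0 <= x -> 0 <= y ->
  Num.sqrt (x + y) <= Num.sqrt x + Num.sqrt y.
Proof.
move=> x0 y0; have s0 : 0 <= Num.sqrt x + Num.sqrt y by rewrite addr_ge0 ?sqrtr_ge0.
rewrite -(ger0_norm s0) -sqrtr_sqr ler_sqrt ?sqr_ge0// sqrrD !sqr_sqrtr//.
by rewrite addrAC lerDl mulrn_wge0// mulr_ge0 ?sqrtr_ge0.
Qed.

Lemma eta_empirical t :
  eta pb tr V t = Num.sqrt (\sum_(r <- residuals) empirical pb tr V r t).
Proof.
have D2 n (w a b : 'I_n -> R) :
    \sum_k w k * (a k + b k) = \sum_k w k * a k + \sum_k w k * b k.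
  by under eq_bigr do rewrite mulrDr; rewrite big_split.
by rewrite /eta /residuals !big_cons big_nil addr0 /= /quadrature !D2 !addrA.
Qed.

Lemma empirical_ge0 r t : weights_ok V -> 0 <= empirical pb tr V r t.
Proof.
move=> [[w1 _] [w2 _] [w3 _] [w4 _]].
by case: r => /=; apply: sumr_ge0 => k _; rewrite mulr_ge0 ?sqr_ge0// ltW.
Qed.

(** Weights that sum to one cannot be indexed by the empty set.  This matters
    because the sign of [C 0] is not prescribed. *)
Lemma sample_size_gt0 r (t : TT) : weights_ok V -> (0 < sample_size V r)%N.
Proof.
have H n (w : 'I_n -> TT -> R) : normalized_weights w -> (0 < n)%N.
  case: n w => // w [_ /(_ t)]; rewrite big_ord0 => /esym/eqP.
  by rewrite oner_eq0.
by move=> [w1 w2 w3 w4]; case: r; eapply H; eassumption.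
Qed.

Lemma residual_le_sum (F : residual -> R) r : (forall r', 0 <= F r') ->
  F r <= \sum_(r' <- residuals) F r'.
Proof.
move=> F0; rewrite /residuals !big_cons big_nil addr0.
have := (F0 Res_y, F0 Res_l, F0 Res_u, F0 Bc_y, F0 Bc_l, F0 Ic_y, F0 Tm_l).
by move=> [[[[[[]]]]]]; case: r; lra.
Qed.

Lemma le_C_ver (C : nat -> R) r : Num.sqrt (C (sample_size V r)) <= C_ver V C.
Proof. by rewrite /C_ver !big_cons; case: r; rewrite !le_max lexx ?orbT. Qed.

Lemma sqrt_quadrature_bound (bexp C' : residual -> R) (C : nat -> R) r t : weights_ok V ->
  (exists K : R, forall n, (0 < n)%N -> 0 <= C n <= K * Num.sqrt n%:R) ->
  (forall r, 0 <= C' r) ->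
  Num.sqrt (C (sample_size V r) * empirical pb tr V r t + quad_term V bexp C' r)
  <= C_ver V C * eta pb tr V t + E_quad V bexp C'.
Proof.
move=> wV [K CK] C'0.
have C0 : 0 <= C (sample_size V r) by case/andP: (CK _ (sample_size_gt0 r t wV)).
have q0 r' : 0 <= quad_term V bexp C' r' by rewrite mulr_ge0// powR_ge0.
have e0 r' := empirical_ge0 r' t wV.
rewrite (le_trans (sqrtrD_le _ _))// ?mulr_ge0// lerD//.
  rewrite sqrtrM// ler_pM ?sqrtr_ge0 ?le_C_ver// eta_empirical ler_wsqrtr//.
  exact: (residual_le_sum (F := fun r => empirical pb tr V r t)).
by rewrite ler_wsqrtr// residual_le_sum.
Qed.

End indicator.

(** * L^2 norms of the residuals *)

Section domains_of_the_residuals.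
Context (R : realType) (m : nat) (pb : problem R m) (b : R) (pbP : setting pb b).
Local Open Scope ereal_scope.

Let leb_dom_fin : leb (dom pb) < +oo.
Proof. by case: pbP => -[_ [_ _ _ bd _] _ _ _] _; exact: lebesgue_bounded_fin. Qed.

Let surf_bdry_fin : surf (bdry (dom pb)) < +oo.
Proof. by case: pbP => -[_ /hausdorff_bdry_fin]. Qed.

Let horizon_gt0 : (0 < horizon pb)%R.
Proof. by case: pbP => -[]. Qed.

Lemma L2_dom_le_average (v : 'rV[R]_m.+1 -> R) (e : R) :
  sqL2av leb (dom pb) v <= e%:E ->
  L2 leb (dom pb) v <= (Num.sqrt (fine (leb (dom pb))) * Num.sqrt e)%:E.
Proof.
apply: L2_le_average => // A _.
exact: (@le_outer_measure _ _ (@lebesgue_outer R m : {outer_measure set _ -> \bar R})).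
Qed.

Lemma L2_Q_le_average (v : 'rV[R]_m.+1 * R -> R) (e : R) :
  sqL2av leb_t (Q pb) v <= e%:E ->
  L2 leb_t (Q pb) v <= (Num.sqrt (fine (leb_t (Q pb))) * Num.sqrt e)%:E.
Proof.
apply: L2_le_average => [|A mA AQ].
  exact: (cylinder_fin (mu := (@lebesgue_outer R m : {outer_measure set _ -> \bar R}))).
exact: (cylinder_monotone (mu := (@lebesgue_outer R m : {outer_measure set _ -> \bar R}))).
Qed.

Lemma L2_Sig_le_average (v : 'rV[R]_m.+1 * R -> R) (e : R) :
  sqL2av surf_t (Sig pb) v <= e%:E ->
  L2 surf_t (Sig pb) v <= (Num.sqrt (fine (surf_t (Sig pb))) * Num.sqrt e)%:E.
Proof.
apply: L2_le_average => [|A mA AS].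
  exact: (cylinder_fin (mu := (@hausdorff_outer R m.+1 m : {outer_measure set _ -> \bar R}))).
exact: (cylinder_monotone (mu := (@hausdorff_outer R m.+1 m : {outer_measure set _ -> \bar R}))).
Qed.

(** [M] dominates a norm over the domain, which is not empty. *)
Lemma trace_bound_ge0 tr b' M : trace_bound pb tr b' M -> (0 <= M)%R.
Proof.
case: pbP => -[_ [_ _ D0 _ _] _ _ _] _ [_ _ [_ TM]].
by rewrite -lee_fin; apply: le_trans TM; exact: holder2_norm_ge0.
Qed.

End domains_of_the_residuals.

Theorem theorem3 (R : realType) (m : nat) (pb : problem R m) (b cf : R)
    (ys us ls : 'rV[R]_m.+1 * R -> R) :
  setting pb b ->
  reference_kkt pb ys us ls ->
  regular_compatible pb b us ->
  nonlinearity pb cf ->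
  exists2 K : R, 0 < K &
  forall (ut : 'rV[R]_m.+1 * R -> R) (cY cL cU : nat -> set (mlp R (m.+1 + 1)))
      (trs : nat -> triple R m)
      (C2 C3 Cstab Cstab' Cnl rho lo hi Mbc : R),
    (forall p, Sig pb p -> ut p = us p) ->
    approximable pb ys ut ls cY cL cU ->
    (forall N, [/\ cY N (netY (trs N)), cL N (netL (trs N)) & cU N (netU (trs N))]) ->
    (forall N, trace_bound pb (trs N) b Mbc) ->
    0 < rho ->
    (forall N, neighborhood pb ys ls (trs N) rho) ->
    lipschitz_range pb ys trs lo hi ->
    0 < C2 -> 0 < C3 ->
    alpha_0 pb ys ls C2 C3 < alpha pb ->
    0 < Cstab -> 0 < Cstab' -> 0 < Cnl ->
    (forall N, stability_constants pb ys ls (trs N) Cstab Cstab' Mbc) ->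
    (forall rho', 0 < rho' <= (2 * Cstab * Cnl)^-1 ->
      forall N, neighborhood pb ys ls (trs N) rho' ->
        (triple_error pb ys us ls (trs N) <=
         stab_rhs pb (trs N) (2 * Cstab) (2 * Cstab') Mbc
           (R_y pb (trs N)) (R_l pb (trs N)))%E) ->
    rho <= (2 * Cstab * Cnl)^-1 ->
    forall (N : nat) (dT : measure_display) (TT : measurableType dT)
        (P : probability TT R) (V : verification_set R m TT)
        (bexp : residual -> R) (C : nat -> R) (C' : residual -> R),
      weights_ok V ->
      space_filling pb P V ->
      quadrature_constants pb P (trs N) V bexp C C' ->
      prob_ge P
        [set t | (triple_error pb ys us ls (trs N) <=
                  (K * (Cstab * (C_ver V C * eta pb (trs N) V t + E_quad V bexp C')
                        + Cstab' * Mbc))%:E)%E]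
        (1 - \sum_(r <- residuals) failure R (sample_size V r)).
Proof.
move=> pbP _ _ _.
(* The averages and the L^2 norms differ by these factors. *)
pose kO := Num.sqrt (fine (leb (dom pb))).
pose kQ := Num.sqrt (fine (leb_t (Q pb))).
pose kS := Num.sqrt (fine (surf_t (Sig pb))).
have [kO0 kQ0 kS0] : [/\ 0 <= kO, 0 <= kQ & 0 <= kS] by split; exact: sqrtr_ge0.
exists (2 * (1 + kO + 2 * kQ + 2 * kS)) => [|ut cY cL cU trs C2 C3 Cs Cs' Cnl rho lo hi M].
  by rewrite mulr_gt0//; lra.
move=> _ _ _ trM rho0 nbh _ _ _ _ Cs0 Cs'0 _ _ stab rho_le N dT TT P V bexp C C'.
move=> wV _ [_ CK C'0 quadE].
have M0 : 0 <= M := trace_bound_ge0 pbP (trM N).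
have rho_ok : 0 < rho <= (2 * Cs * Cnl)^-1 by rewrite rho0.
apply: prob_ge_sub (prob_ge_bigsetI residuals quadE) => t.
rewrite /residuals !big_cons big_nil => -[hy [hl [hu [hby [_ [hic _]]]]]] /=.
apply: (le_trans (stab _ rho_ok N (nbh N))).
set Z := C_ver V C * eta pb (trs N) V t + E_quad V bexp C'.
have qZ r := sqrt_quadrature_bound pb (trs N) bexp r t wV CK C'0.
have Z0 : 0 <= Z by exact: le_trans (sqrtr_ge0 _) (qZ Ic_y).
have bound (e k : R) (x : \bar R) : 0 <= k -> (x <= (k * Num.sqrt e)%:E)%E ->
    Num.sqrt e <= Z -> (x <= (k * Z)%:E)%E.
  by move=> k0 /le_trans H eZ; apply: H; rewrite lee_fin ler_wpM2l.
rewrite /stab_rhs L2N.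
have Bic := bound _ _ _ kO0 (L2_dom_le_average pbP hic) (qZ Ic_y).
have By := bound _ _ _ kQ0 (L2_Q_le_average pbP hy) (qZ Res_y).
have Bl := bound _ _ _ kQ0 (L2_Q_le_average pbP hl) (qZ Res_l).
have Bu := bound _ _ _ kS0 (L2_Sig_le_average pbP hu) (qZ Res_u).
have Bby := bound _ _ _ kS0 (L2_Sig_le_average pbP hby) (qZ Bc_y).
have := leeD (leeD (leeD (leeD Bic By) Bl) Bu) Bby.
rewrite -!EFinD => sumB.
apply: (@le_trans _ _ ((2 * Cs * (kO * Z + kQ * Z + kQ * Z + kS * Z + kS * Z))%:E
                        + (2 * Cs' * M)%:E)%E).
  by rewrite leeD2r// [leRHS]EFinM lee_wpmul2l// lee_fin mulr_ge0// ltW.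
rewrite -EFinD lee_fin -subr_ge0.
rewrite (_ : _ - _ = 2 * (Cs * Z) + 2 * (kO + 2 * kQ + 2 * kS) * (Cs' * M)); last by ring.
have k0 : 0 <= kO + 2 * kQ + 2 * kS by lra.
by apply: addr_ge0; do 2?apply: mulr_ge0 => //; apply: ltW.
Qed.
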